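(* Let $n \ge 1$ be an integer and let $k=\lceil n/2\rceil$. Place barriers in the Aztec diamond of order $n$ along its spine squares, numbered $1,2,\dots,2k$ from southwest to northeast, so that for each even $i\in\{2,4,\dots,2k\}$ the $i$th spine square receives either a zig or a zag (chosen arbitrarily and independently for each even $i$), and for each odd $i$ the $i$th spine square receives a zip (no barriers); no other barriers are placed. Then the number of domino tilings of the Aztec diamond of order $n$ that are compatible with this placement of barriers is $$2^{n(n+1)/2}/2^{k}.$$
   Context: The Aztec diamond of order $n$ is the region composed of $2n(n+1)$ unit squares of the square grid, arranged in a bilaterally symmetric fashion as a stack of $2n$ rows of squares, the rows having lengths $2,4,6,\dots,2n-2,2n,2n,2n-2,\dots,6,4,2$. In coordinates with the center of the region at the origin, it is the union of the unit squares $[a,a+1]\times[b,b+1]$ ($a,b\in\mathbb{Z}$) contained in $\{(x,y): |x|+|y|\le n+1\}$. A domino is a 1-by-2 or 2-by-1 rectangle made of two grid squares sharing an edge. A domino tiling of the region is a partition of its unit squares into dominoes. A barrier is an edge of the square grid that no domino is permitted to cross. A domino crosses the edge shared by its two unit squares. A domino tiling is compatible with a placement of barriers if none of its dominoes crosses a barrier. The spine is the line of slope 1 through the center of the Aztec diamond. It passes through (the interiors of) exactly $2k$ unit squares of the Aztec diamond, where $k=\lceil n/2\rceil$; these are numbered $1$ through $2k$ from lower left (southwest) to upper right (northeast). In the coordinates above, the $i$th spine square is $[i-1-k,\,i-k]\times[i-1-k,\,i-k]$. At a spine square, a ''zig'' means placing barriers on its bottom and right edges, a ''zag'' means placing barriers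 on its left and top edges, and a ''zip'' means placing no barriers. *)

(* Defs.v *)
From mathcomp Require Import all_boot all_order all_algebra.
From mathcomp Require Import lra zify.

Set Implicit Arguments.
Unset Strict Implicit.
Unset Printing Implicit Defensive.

Import Order.TTheory GRing.Theory Num.Theory.
Local Open Scope ring_scope.

(* A unit square of the grid is named by its lower left corner. *)
Definition square : Type := (int * int)%type.

(* A grid edge is the pair of its endpoints, the left or lower one first. *)
Definition edge : Type := ((int * int) * (int * int))%type.

Definition bottom_edge (s : square) : edge := (s, (s.1 + 1, s.2)).
Definition left_edge (s : square) : edge := (s, (s.1, s.2 + 1)).
Definition top_edge (s : square) : edge :=
  ((s.1, s.2 + 1), (s.1 + 1, s.2 + 1)).
Definition right_edge (s : square) : edge :=
  ((s.1 + 1, s.2), (s.1 + 1, s.2 + 1)).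

Definition sides (s : square) : seq edge :=
  [:: bottom_edge s; right_edge s; top_edge s; left_edge s].

(* The square [a, a+1] x [b, b+1] lies in {|x| + |y| <= n + 1}, tested on its
   four corners; see aztec_squareP. *)
Definition aztec_square (n : nat) (s : square) : bool :=
  [&& `|s.1| + `|s.2| <= n.+1%:Z,
      `|s.1 + 1| + `|s.2| <= n.+1%:Z,
      `|s.1| + `|s.2 + 1| <= n.+1%:Z
    & `|s.1 + 1| + `|s.2 + 1| <= n.+1%:Z].

Lemma aztec_squareP (R : realFieldType) (n : nat) (s : square) :
  aztec_square n s <->
  (forall x y : R, s.1%:~R <= x <= s.1%:~R + 1 ->
     s.2%:~R <= y <= s.2%:~R + 1 -> `|x| + `|y| <= n%:R + 1).
Proof.
case: s => a b /=.
have cornerE (u v : int) : (`|u| + `|v| <= n.+1%:Z) =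
    (`|u%:~R| + `|v%:~R| <= n%:R + 1 :> R).
  by rewrite -(ler_int R) rmorphD /= !intr_norm -pmulrn -natr1.
rewrite /aztec_square !cornerE !rmorphD /=.
split=> [/and4P[c1 c2 c3 c4] x y /andP[x1 x2] /andP[y1 y2] | H].
  have absP (z t : R) : `|z| <= t -> - t <= z /\ z <= t.
    by rewrite ler_norml => /andP[].
  have absD (u v t : R) : `|u| + `|v| <= t ->
      [/\ u + v <= t, u - v <= t, v - u <= t & - u - v <= t].
    move=> h; have [? ?] := absP u _ (lexx _); have [? ?] := absP v _ (lexx _).
    by split; lra.
  move: (absD _ _ _ c1) (absD _ _ _ c2) (absD _ _ _ c3) (absD _ _ _ c4).
  move=> [? ? ? ?] [? ? ? ?] [? ? ? ?] [? ? ? ?].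
  by case: (ger0P x) => _; case: (ger0P y) => _; lra.
by apply/and4P; split; apply: H; apply/andP; split; lra.
Qed.

(* Every square of the Aztec diamond of order n has its lower left corner in
   [-n, n-1] x [-n, n-1] (aztec_square_in_box); the squares of that box form
   a finite type, with indices shifted by n. *)
Definition cell (n : nat) : finType := ('I_n.*2 * 'I_n.*2)%type.

Definition square_of (n : nat) (c : cell n) : square :=
  (c.1%:Z - n%:Z, c.2%:Z - n%:Z).

Lemma aztec_square_in_box (n : nat) (s : square) :
  aztec_square n s -> exists c : cell n, square_of c = s.
Proof.
case: s => a b /and4P[/= h1 h2 h3 h4].
have ha : (absz (a + n%:Z)%R < n.*2)%N by lia.
have hb : (absz (b + n%:Z)%R < n.*2)%N by lia.
by exists (Ordinal ha, Ordinal hb); rewrite /square_of /=; congr pair; lia.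
Qed.

Definition aztec (n : nat) : {set cell n} :=
  [set c | aztec_square n (square_of c)].

Definition share_edge (s t : square) : bool :=
  (s != t) && has (mem (sides t)) (sides s).

Definition is_domino (n : nat) (D : {set cell n}) : bool :=
  [exists s : cell n, exists t : cell n,
    share_edge (square_of s) (square_of t) && (D == [set s; t])].

Definition domino_tiling (n : nat) (P : {set {set cell n}}) : bool :=
  partition P (aztec n) && [forall D in P, is_domino D].

(* For a domino D: e is the edge shared by its two squares. *)
Definition crosses (n : nat) (D : {set cell n}) (e : edge) : bool :=
  [forall c in D, e \in sides (square_of c)].

Definition compatible (n : nat) (B : seq edge) (P : {set {set cell n}}) : bool :=
  [forall D in P, ~~ has (crosses D) B].

Inductive spine_mark : Set := Zig | Zag | Zip.

Definition mark_barriers (m : spine_mark) (s : square) : seq edge :=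
  match m with
  | Zig => [:: bottom_edge s; right_edge s]
  | Zag => [:: left_edge s; top_edge s]
  | Zip => [::]
  end.

(* uphalf n is the ceiling of n / 2. *)
Definition spine_square (n i : nat) : square :=
  (i%:Z - 1 - (uphalf n)%:Z, i%:Z - 1 - (uphalf n)%:Z).

Lemma spine_squareP (n : nat) (a : int) :
  aztec_square n (a, a) <->
  exists2 i, (1 <= i <= (uphalf n).*2)%N & spine_square n i = (a, a).
Proof.
rewrite /aztec_square /spine_square /=; split.
  move=> /and4P[h1 h2 h3 h4].
  by exists (absz (a + 1 + (uphalf n)%:Z)); [lia | congr pair; lia].
by move=> [i hi [ha _]]; apply/and4P; split; lia.
Qed.

(* Only the values of m on 1, ..., 2 * uphalf n matter. *)
Definition spine_barriers (n : nat) (m : nat -> spine_mark) : seq edge :=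
  flatten [seq mark_barriers (m i) (spine_square n i)
          | i <- iota 1 (uphalf n).*2].

(* Main.v *)
Require Import Defs.
From mathcomp Require Import all_boot all_order all_algebra all_fingroup.
From mathcomp Require Import zify ring.

(** Cut the Aztec diamond along the diagonals of slope 1.  Every domino joins two
neighbouring diagonals, so a tiling is a tiling of the part above the spine
together with a set [A] of spine squares, and a tiling of the part below the
spine together with the remaining spine squares.  A zig puts its square in [A],
a zag keeps it out, a zip leaves the choice free.  Hence the number of
compatible tilings is the sum, over the sets [A] allowed by the marks, of the
product of two half counts ([covers_aztec]).

The half counts.  Let [vdm A] be the product of the differences [y - x], for
[x < y] in [A].  If [A] consists of [k = uphalf n] spine squares, half of all of
them, then a half diamond together with [A] has [c * vdm A] or [c * vdm (~: A)] tilings, according to the parity of [n], where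
the constant [c] depends only on [n] ([region_covers]).  This is proved by
peeling off the diagonals one at a time: each prescribed square of a diagonal
is covered together with one of its two neighbours on the next diagonal, and
the number of tilings is the sum over all such choices of the numbers for the
smaller region ([covers_peel]).  The two neighbours of [x] lie at [x]
and [x + 1], or at [x - 1] and [x], on a whole diagonal.  The choices thus
preserve order, so that no signs appear, and choices that collide contribute
zero to the difference product.  The difference
product is a Vandermonde determinant, and a determinant is linear in each
column; so the sum over all choices is the determinant in which each column is
replaced by a weighted sum of the columns of the two neighbours.  That replacement
sends [x^j] to a polynomial of degree [j] in [x], up to a weight that depends on
[x] alone, and hence only multiplies the Vandermonde determinant by these weights
and by the product of the leading coefficients
([sum_choice_vandermonde_poly]).  On the steps towards a longer diagonal the
same argument is applied to the complements of the sets, whose difference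
products are related by [vdm_setD].

The sum over [A].  By the half counts it remains to sum [vdm A * vdm (~: A)]
over the sets [A] of [k] spine squares that contain the zigs and avoid the
zags.  Put [v_i = (1, i, ..., i^(k-1))].  By Laplace expansion along the two
blocks of [k] rows, that sum is, up to sign, the determinant of order [2k] with
columns [(v_i; v_i)] at a zip, [(v_i; 0)] at a zig and [(0; v_i)] at a zag.
Subtracting the upper block from the lower one gives columns [(v_i; 0)],
[(v_i; - v_i)] and [(0; v_i)], and now only one term survives in the expansion:
the zips fill the upper block, the marked squares the lower one.  The sum is
therefore [vdm zips * vdm marked] for every placement of the marks
([sum_vdm_half_prescribed]), and powers of 2 are all that is left.

Positions on a diagonal are counted from 0, so the [i]-th spine square is at
position [i - 1] and the marked squares are at the odd positions. *)

Set Implicit Arguments.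
Unset Strict Implicit.
Unset Printing Implicit Defensive.

Import Order.TTheory GRing.Theory Num.Theory.

(** * Exact covers of a finite set by prescribed blocks *)

Section Covers.
Variable T : finType.
Implicit Types (K P : {set {set T}}) (X Y B : {set T}).

Definition covers K X : nat := #|[set P | partition P X & P \subset K]|.

Lemma partitionU P1 P2 X Y : Y \subset X ->
  partition P1 Y -> partition P2 (X :\: Y) -> partition (P1 :|: P2) X.
Proof.
move=> sYX /and3P[/eqP c1 t1 n1] /and3P[/eqP c2 t2 n2].
apply/and3P; split.
- apply/eqP; rewrite /cover bigcup_setU -!/(cover _) c1 c2.
  by rewrite setDE setUIr setUCr setIT; apply/setUidPr.
- by apply: trivIsetU => //; rewrite c1 c2 disjoints_subset setCD subsetUr.
- by rewrite inE negb_or n1.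
Qed.

Lemma partition_setI P K X : partition P X ->
  partition (P :&: K) (cover (P :&: K)).
Proof.
move=> /and3P[_ tP nP]; apply/and3P; split => //.
  by apply: trivIsetS tP; apply: subsetIl.
by rewrite inE negb_and nP.
Qed.

Lemma cover_setID P K X : partition P X ->
  cover (P :\: K) = X :\: cover (P :&: K).
Proof.
move=> /and3P[/eqP cP /trivIsetP tP nP].
apply/setP => x; rewrite -cP !inE.
apply/bigcupP/andP => [[B /setDP[BP BK] xB]|[nx /bigcupP[B BP xB]]].
  split; last by apply/bigcupP; exists B.
  apply/negP => /bigcupP[C /setIP[CP CK] xC].
  case: (eqVneq B C) => [eBC|neBC]; first by rewrite eBC CK in BK.
  by have /pred0P /(_ x) := tP _ _ BP CP neBC; rewrite /= xB xC.
exists B => //; rewrite inE BP andbT; apply: contra nx => BK.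
by apply/bigcupP; exists B => //; rewrite inE BP.
Qed.

(** A cover by blocks of two kinds is determined by the region [Y] that the blocks
of the first kind fill. *)
Lemma covers_split K1 K2 X : [disjoint K1 & K2] ->
  covers (K1 :|: K2) X =
  \sum_(Y : {set T} | Y \subset X) covers K1 Y * covers K2 (X :\: Y).
Proof.
move=> /setDidPl dK; rewrite {1}/covers -sum1_card.
rewrite (partition_big (fun P => cover (P :&: K1)) (fun Y => Y \subset X)) /=;
  last first.
  move=> P; rewrite inE => /andP[pP _]; rewrite -(cover_partition pP).
  apply/bigcupsP => B /setIP[BP _]; exact: bigcup_sup.
apply: eq_bigr => Y sYX; rewrite /covers -cardsX.
set A := setX _ _.
have e1 P1 P2 : P1 \subset K1 -> P2 \subset K2 -> (P1 :|: P2) :&: K1 = P1.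
  move=> s1 s2; rewrite setIUl (setIidPl s1); apply/setUidPl.
  rewrite -dK setIDA; apply/subsetP => B; rewrite !inE => /and3P[nB B2 _].
  by rewrite (subsetP s2) in nB.
have e2 P1 P2 : P1 \subset K1 -> P2 \subset K2 -> (P1 :|: P2) :\: K1 = P2.
  move=> s1 s2; rewrite setDUl; move: (s1); rewrite -setD_eq0 => /eqP ->.
  rewrite set0U; apply/setDidPl; rewrite disjoint_sym.
  by apply: disjointWr s2 _; apply/setDidPl.
have injU : {in A &, injective (fun q : {set {set T}} * {set {set T}} => q.1 :|: q.2)}.
  move=> [P1 P2] [Q1 Q2]; rewrite !inE /=.
  move=> /andP[/andP[_ s1] /andP[_ s2]] /andP[/andP[_ s3] /andP[_ s4]] eU.
  by rewrite -(e1 P1 P2) // -{2}(e2 P1 P2) // eU e1 // e2.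
rewrite -(card_in_imset injU) -sum1_card; apply: eq_bigl => P.
rewrite inE; apply/andP/imsetP => [[/andP[pP sP] /eqP cP]|].
  exists (P :&: K1, P :\: K1); last by rewrite /= setID.
  rewrite !inE /= -cP (partition_setI _ pP) subsetIr /=.
  rewrite -(cover_setID K1 pP) setDE (partition_setI _ pP) -setDE /=.
  by rewrite subDset.
case=> -[P1 P2]; rewrite !inE /= => /andP[/andP[p1 s1] /andP[p2 s2]] ->.
rewrite (partitionU sYX) //= setUSS // e1 //; split=> //.
by rewrite (cover_partition p1).
Qed.

Lemma eq_covers K K' X :
  (forall B, B \subset X -> (B \in K) = (B \in K')) -> covers K X = covers K' X.
Proof.
move=> eK; rewrite /covers; apply: eq_card => P; rewrite !inE.
case pP : (partition P X) => //=; apply/subsetP/subsetP => sP B BP.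
  by rewrite -eK ?sP // (partitionS pP).
by rewrite eK ?sP // (partitionS pP).
Qed.

Lemma covers_eq0 K X x : x \in X -> (forall B, B \subset X -> B \in K -> x \notin B) ->
  covers K X = 0.
Proof.
move=> xX nK; apply/eqP; rewrite cards_eq0; apply/eqP/setP => P; rewrite !inE.
apply/negP => /andP[pP sP].
have xc : x \in cover P by rewrite (cover_partition pP).
have BP := pblock_mem xc.
have := nK _ (partitionS pP BP) (subsetP sP _ BP).
by rewrite mem_pblock xc.
Qed.

Lemma covers0 K : covers K set0 = 1.
Proof.
rewrite /covers -(cards1 (set0 : {set {set T}})); apply: eq_card => P.
rewrite !inE partition_set0; apply/andP/idP => [[]//|/eqP ->].
by rewrite eqxx sub0set.
Qed.

Section Peel.
Variables (I J : finType) (a : I -> T) (c : J -> T) (J0 : {set J}).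
Variables (nb : I -> J -> bool) (K : {set {set T}}).
Hypothesis a_inj : injective a.
Hypothesis c_inj : {in J0 &, injective c}.
Hypothesis acN : forall i j, j \in J0 -> a i != c j.
Hypothesis nbK : forall i j, j \in J0 -> nb i j -> [set a i; c j] \in K.

Definition is_choice (h : {ffun I -> J}) : bool :=
  injectiveb h && [forall i, (h i \in J0) && nb i (h i)].

Definition choice_set (h : {ffun I -> J}) : {set T} :=
  [set a i | i in I] :|: [set c (h i) | i in I].

Definition choice_blocks (h : {ffun I -> J}) : {set {set T}} :=
  [set [set a i; c (h i)] | i in I].

Lemma choice_blocks_partition h : is_choice h ->
  partition (choice_blocks h) (choice_set h).
Proof.
move=> /andP[/injectiveP h_inj /forallP hP].
have hJ i : h i \in J0 by have /andP[] := hP i.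
have ab i j : a i \in [set a j; c (h j)] -> i = j.
  by rewrite !inE (negbTE (acN _ (hJ j))) orbF => /eqP /a_inj.
have n0 : set0 \notin choice_blocks h.
  by apply/imsetP => -[i _ /setP /(_ (a i))]; rewrite !inE eqxx.
apply/and3P; split => //.
- rewrite cover_imset; apply/eqP/setP => x; rewrite inE.
  apply/bigcupP/orP => [[i _]|[] /imsetP[i _ ->]].
  + by rewrite !inE => /orP[] /eqP ->; [left|right]; apply/imsetP; exists i.
  + by exists i => //; rewrite !inE eqxx.
  + by exists i => //; rewrite !inE eqxx orbT.
- apply: (proj1 (trivIimset _ _)) => // i j _ _ nij.
  rewrite -setI_eq0; apply/eqP/setP => x; rewrite !inE.
  apply/negP => /andP[/orP[] /eqP -> /orP[]].
  + by move=> /eqP /a_inj e; rewrite e eqxx in nij.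
  + by rewrite (negbTE (acN _ (hJ j))).
  + by rewrite eq_sym (negbTE (acN _ (hJ i))).
  + by move=> /eqP /c_inj -/(_ (hJ i) (hJ j)) /h_inj e; rewrite e eqxx in nij.
Qed.

Lemma choice_blocks_inj : {in [pred h | is_choice h] &, injective choice_blocks}.
Proof.
move=> h h' /andP[_ /forallP hP] /andP[_ /forallP hP'] e.
apply/ffunP => i.
have hJ k : h k \in J0 by have /andP[] := hP k.
have hJ' k : h' k \in J0 by have /andP[] := hP' k.
have : [set a i; c (h i)] \in choice_blocks h' by rewrite -e; apply/imsetP; exists i.
case/imsetP => j _ /setP E.
have := E (a i); rewrite !inE eqxx (negbTE (acN _ (hJ' j))) /= orbF.
move=> /esym /eqP /a_inj ij; subst j.
have := E (c (h i)); rewrite !inE eqxx orbT eq_sym (negbTE (acN _ (hJ i))) /=.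
by move=> /esym /eqP /c_inj; apply.
Qed.

(** If the only blocks meeting the points [a i] are the pairs [[set a i; c j]], then
a cover is a choice of partners for these points followed by a cover of what
remains. *)
Lemma covers_peel X :
  (forall i, a i \in X) -> (forall j, j \in J0 -> c j \in X) ->
  (forall (B : {set T}) i, B \subset X -> B \in K -> a i \in B ->
     exists2 j, j \in J0 & nb i j /\ B = [set a i; c j]) ->
  covers K X =
  \sum_(h : {ffun I -> J} | is_choice h) covers K (X :\: choice_set h).
Proof.
move=> aX cX XK.
pose K1 := [set B in K | [exists i, a i \in B]].
have sK1 : K1 \subset K by apply/subsetP => B; rewrite inE => /andP[].
have -> : covers K X = covers (K1 :|: (K :\: K1)) X.
  by congr covers; rewrite -{1}(setID K K1); congr (_ :|: _); apply/setIidPr.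
have aY h : is_choice h -> forall i, a i \in choice_set h.
  by move=> _ i; rewrite inE imset_f.
rewrite covers_split; last first.
  by rewrite disjoint_sym; apply/setDidPl; rewrite setDDl setUid.
rewrite [RHS](partition_big choice_set (fun Y : {set T} => Y \subset X)); last first.
  move=> h /andP[_ /forallP hP]; apply/subUsetP.
  split; apply/subsetP => x /imsetP[i _ ->] //; apply: cX.
  by have /andP[] := hP i.
apply: eq_bigr => Y sYX.
have [/forallP aIY|] := boolP [forall i, a i \in Y]; last first.
  rewrite negb_forall => /existsP[i niY].
  rewrite (@covers_eq0 (K :\: K1) _ (a i)); last first.
  - move=> B _; rewrite !inE negb_and => /andP[/orP[/negbTE -> //|nB] _].
    by apply: contra nB => iB; apply/existsP; exists i.
  - by rewrite inE niY aX.
  rewrite muln0 big_pred0 // => h; apply/negbTE/negP => /andP[hc /eqP eY].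
  by rewrite -eY aY in niY.
rewrite (eq_bigr (fun=> covers K (X :\: Y))); last by move=> h /andP[_ /eqP ->].
rewrite sum_nat_const; congr (_ * _); last first.
  apply: eq_covers => B /subsetP sB; rewrite !inE.
  case BK : (B \in K) => /=; rewrite ?andbF // andbT.
  by apply/existsPn => i; apply/negP => /sB; rewrite inE aIY.
rewrite /covers.
rewrite -(@card_in_imset _ _ choice_blocks [pred h | is_choice h && (choice_set h == Y)]);
  last first.
  by move=> h h' /andP[hc _] /andP[hc' _]; apply: choice_blocks_inj.
apply: eq_card => P; rewrite inE; apply/andP/imsetP => [[pP sP]|].
  have /fin_all_exists[f fP] i : exists j, [/\ j \in J0, nb i j &
      [set a i; c j] \in P].
    have iP : a i \in cover P by rewrite (cover_partition pP).
    have BP := pblock_mem iP; have := subsetP sP _ BP.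
    rewrite inE => /andP[BK _].
    have [] := XK _ i _ BK; rewrite ?mem_pblock //.
      by apply: subset_trans sYX; apply: partitionS pP BP.
    by move=> j jJ [nj eB]; exists j; split => //; rewrite -eB.
  pose h := [ffun i => f i].
  have hJ i : h i \in J0 by rewrite ffunE; have [] := fP i.
  have nbh i : nb i (h i) by rewrite ffunE; have [] := fP i.
  have hPi i : [set a i; c (h i)] \in P by rewrite ffunE; have [] := fP i.
  have /trivIsetP tP := partition_trivIset pP.
  have hc : is_choice h.
    apply/andP; split; last by apply/forallP => i; rewrite hJ nbh.
    apply/injectiveP => i i' eh; apply: contraTeq isT => nii.
    have neB : [set a i; c (h i)] != [set a i'; c (h i')].
      apply/negP => /eqP /setP /(_ (a i)); rewrite !inE eqxx.
      rewrite (negbTE (acN _ (hJ i'))) orbF /= => /esym /eqP /a_inj e.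
      by rewrite e eqxx in nii.
    have /pred0P /(_ (c (h i))) := tP _ _ (hPi i) (hPi i') neB.
    by rewrite /= !inE eh eqxx !orbT.
  have eP : P = choice_blocks h.
    apply/setP => B; apply/idP/imsetP => [BP|[i _ ->] //].
    have := subsetP sP _ BP; rewrite inE => /andP[_ /existsP[i iB]].
    exists i => //; apply: contraTeq iB => nB.
    have /pred0P /(_ (a i)) := tP _ _ BP (hPi i) nB.
    by rewrite /= !inE eqxx /= andbT => ->.
  exists h => //; rewrite !inE hc /=.
  by rewrite -(cover_partition (choice_blocks_partition hc)) -eP (cover_partition pP).
case=> h /andP[hc /eqP <-] ->; split; first exact: choice_blocks_partition.
apply/subsetP => B /imsetP[i _ ->]; have /andP[_ /forallP /(_ i) /andP[hJ hn]] := hc.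
by rewrite inE nbK //; apply/existsP; exists i; rewrite !inE eqxx.
Qed.

End Peel.

End Covers.

(** * Sums of Vandermonde determinants over independent choices *)

Local Open Scope ring_scope.

(** Multilinearity in the columns, with the choices of the summands collected in
[h]. *)
Lemma det_col_sum (R : comNzRingType) (I : finType) n (F : 'I_n -> I -> 'I_n -> R) :
  \det (\matrix_(j, i) \sum_q F i q j) =
  \sum_(h : {ffun 'I_n -> I}) \det (\matrix_(j, i) F i (h i) j).
Proof.
rewrite -det_tr {1}/determinant; under eq_bigr => s _.
  under eq_bigr => i _ do rewrite !mxE.
  rewrite bigA_distr_bigA big_distrr /=; over.
rewrite exchange_big; apply: eq_bigr => h _ /=.
rewrite -[RHS]det_tr; apply: eq_bigr => s _; congr (_ * _).
by apply: eq_bigr => i _; rewrite !mxE.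
Qed.

Lemma det_scale_col (R : comNzRingType) n (W : 'I_n -> R) (F : 'I_n -> 'I_n -> R) :
  \det (\matrix_(j, i) (W i * F j i)) = \prod_i W i * \det (\matrix_(j, i) F j i).
Proof.
have -> : \matrix_(j, i) (W i * F j i) = (\matrix_(j, i) F j i) *m diag_mx (\row_i W i).
  by apply/matrixP => j i; rewrite mul_mx_diag !mxE mulrC.
rewrite det_mulmx det_diag mulrC; congr (_ * _).
by apply: eq_bigr => i _; rewrite mxE.
Qed.

(** For each [h] the double product is the Vandermonde determinant of the points
[y (h i)], and [det_col_sum] moves the sum over [h] into its columns. *)
Lemma sum_choice_vandermonde (R : comNzRingType) (I : finType) r
  (w : 'I_r -> I -> R) (y : I -> R) :
  \sum_(h : {ffun 'I_r -> I}) \prod_i w i (h i) *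
     \prod_(i < r) \prod_(j < r | (i < j)%N) (y (h j) - y (h i)) =
  \det (\matrix_(j < r, i < r) \sum_q w i q * y q ^+ j).
Proof.
rewrite (det_col_sum (fun i q j => w i q * y q ^+ j)).
apply: eq_bigr => h _; rewrite (det_scale_col _ (fun j i => y (h i) ^+ j)).
congr (_ * _); have := det_Vandermonde (\row_i y (h i)).
rewrite /Vandermonde => E; rewrite [RHS](_ : _ = \det (\matrix_(i < r, j < r) (\row_i0 y (h i0)) 0 j ^+ i)).
  by rewrite E; apply: eq_bigr => i _; apply: eq_bigr => j _; rewrite !mxE.
by congr (\det _); apply/matrixP => i j; rewrite !mxE.
Qed.

(** When the column sums are polynomials of degree at most [j] in new points [x i],
the determinant factors through a triangular matrix of coefficients, and only
the coefficients on its diagonal matter. *)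
Lemma sum_choice_vandermonde_poly (R : comNzRingType) (I : finType) r
  (w : 'I_r -> I -> R) (y : I -> R) (W x : 'I_r -> R) (P : nat -> {poly R}) :
  (forall j, (size (P j) <= j.+1)%N) ->
  (forall i j, \sum_q w i q * y q ^+ j = W i * (P j).[x i]) ->
  \sum_(h : {ffun 'I_r -> I}) \prod_i w i (h i) *
     \prod_(i < r) \prod_(j < r | (i < j)%N) (y (h j) - y (h i)) =
  (\prod_i W i) * (\prod_(j < r) (P j)`_j) *
     \prod_(i < r) \prod_(j < r | (i < j)%N) (x j - x i).
Proof.
move=> sP momP; rewrite sum_choice_vandermonde.
have -> : \matrix_(j < r, i < r) (\sum_q w i q * y q ^+ j) =
    \matrix_(j, i) (W i * (P j).[x i]).
  by apply/matrixP => j i; rewrite !mxE momP.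
rewrite (det_scale_col _ (fun j i => (P (j : 'I_r)).[x i])) -mulrA; congr (_ * _).
pose C : 'M[R]_r := \matrix_(j, l) (P j)`_l.
have -> : \matrix_(j < r, i < r) (P j).[x i] = C *m Vandermonde r (\row_i x i).
  apply/matrixP => j i; rewrite !mxE (horner_coef_wide _ (leq_trans (sP j) (ltn_ord j))).
  by apply: eq_bigr => l _; rewrite !mxE.
rewrite det_mulmx det_Vandermonde det_trig; last first.
  apply/is_trig_mxP => i j ij; rewrite mxE nth_default //; exact: leq_trans (sP i) ij.
congr (_ * _); first by apply: eq_bigr => i _; rewrite mxE.
by apply: eq_bigr => i _; apply: eq_bigr => j _; rewrite !mxE.
Qed.

(** The powers of X cancel to the top order; the next coefficient is needed in
[vandermonde_step_down]. *)
Lemma shift_poly_coef (R : comNzRingType) (c : R) j :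
  (size (('X + c%:P) ^+ j - 'X^j)%R <= j)%N /\
  (('X + c%:P) ^+ j - 'X^j)`_j.-1 = c *+ j.
Proof.
elim: j => [|j [IHs IHc]]; first by rewrite !expr0 subrr size_poly0 coef0 mulr0n.
have -> : ('X + c%:P) ^+ j.+1 - 'X^(j.+1) =
    'X * (('X + c%:P) ^+ j - 'X^j) + c%:P * ('X + c%:P) ^+ j :> {poly R}.
  by rewrite !exprS; ring.
have pE := esym (subrK ('X^j : {poly R}) (('X + c%:P) ^+ j)).
have sE : (size (('X + c%:P) ^+ j)%R <= j.+1)%N.
  rewrite pE; apply: leq_trans (size_polyD _ _) _.
  by rewrite geq_max size_polyXn leqnn andbT leqW.
have cE : (('X + c%:P) ^+ j)`_j = 1.
  rewrite pE coefD coefXn eqxx nth_default ?add0r //.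
split.
  apply: (leq_trans (size_polyD _ _)); rewrite geq_max mulrC.
  apply/andP; split.
    have [->|nz] := eqVneq (('X + c%:P) ^+ j - 'X^j) 0; first by rewrite mul0r size_poly0.
    by rewrite size_mulX.
  rewrite mul_polyC; exact: leq_trans (size_scale_leq _ _) sE.
rewrite coefD coefXM coefCM cE mulr1 /=.
case: j IHs IHc {pE sE cE} => [|j] IHs IHc /=; first by rewrite add0r.
by rewrite IHc -mulrSr.
Qed.

(** The sum of the values of [X^j] at a point and at its successor. *)
Lemma vandermonde_step_up (R : comNzRingType) j (P := 'X^j + ('X + 1) ^+ j : {poly R}) :
  (size P <= j.+1)%N /\ P`_j = 2%:R.
Proof.
have [s _] := shift_poly_coef (1 : R) j.
have -> : P = 'X^j *+ 2 + (('X + 1%:P) ^+ j - 'X^j) by rewrite /P mulr2n; ring.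
split; last by rewrite coefD coefMn coefXn eqxx nth_default // addr0.
apply: (leq_trans (size_polyD _ _)); rewrite geq_max (leqW s) andbT.
rewrite -scaler_nat; apply: leq_trans (size_scale_leq _ _) _.
by rewrite size_polyXn.
Qed.

(** The weighted sum of the values of [X^j] at [x - 1] and [x] that comes from the
weights of [sum_vdm_down]; the terms of degree [j + 1] cancel. *)
Lemma vandermonde_step_down (R : comNzRingType) (n j : nat)
  (P := 'X * ('X - 1) ^+ j + (n%:R%:P - 'X) * 'X^j : {poly R}) :
  (size P <= j.+1)%N /\ P`_j = n%:R - j%:R.
Proof.
have [s c] := shift_poly_coef (- 1 : R) j.
have -> : P = n%:R *: 'X^j + (('X + (-1)%:P) ^+ j - 'X^j) * 'X.
  by rewrite /P -mul_polyC polyCN; ring.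
split.
  apply: (leq_trans (size_polyD _ _)); rewrite geq_max; apply/andP; split.
    by apply: (leq_trans (size_scale_leq _ _)); rewrite size_polyXn.
  have [->|nz] := eqVneq ((('X + (-1)%:P) ^+ j - 'X^j) : {poly R}) 0.
    by rewrite mul0r size_poly0.
  by rewrite size_mulX.
rewrite coefD coefZ coefXn eqxx mulr1 coefMX.
by case: j s c {P} => [|j] s c; rewrite ?subr0 ?addr0 //= c mulNrn.
Qed.

(** * Difference products of sets of positions *)

Definition vdm N (A : {set 'I_N}) : rat :=
  \prod_(x in A) \prod_(y in A | (x < y)%N) (y%:R - x%:R).

Lemma homo_ltn_mono N r (x : 'I_r -> 'I_N) :
  {homo x : i j / (i < j)%N} -> {mono x : i j / (i < j)%N}.
Proof.
move=> xh i j; case: (ltngtP i j) => [/xh//|/xh h|/val_inj ->].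
  by apply/negbTE; rewrite -leqNgt ltnW.
by rewrite ltnn.
Qed.

Lemma homo_ltn_inj N r (x : 'I_r -> 'I_N) :
  {homo x : i j / (i < j)%N} -> injective x.
Proof.
move=> xh i j e; apply/val_inj.
by case: (ltngtP i j) => [/xh|/xh|//]; rewrite e ltnn.
Qed.

Lemma vdm_imset N r (x : 'I_r -> 'I_N) :
  {homo x : i j / (i < j)%N} ->
  vdm [set x i | i in 'I_r] = \prod_(i < r) \prod_(j < r | (i < j)%N) ((x j)%:R - (x i)%:R).
Proof.
move=> xh.
have xm := homo_ltn_mono xh.
have x_inj := homo_ltn_inj xh.
rewrite /vdm big_imset /=; last by move=> i j _ _; apply: x_inj.
apply: eq_bigr => i _; rewrite big_mkcondr big_imset /=; last by move=> ? ? _ _; apply: x_inj.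
by rewrite -big_mkcondr /=; apply: eq_bigl => j; rewrite xm.
Qed.

Lemma vdm_enum N (A : {set 'I_N}) r (e : #|A| = r) :
  exists2 x : 'I_r -> 'I_N, {homo x : i j / (i < j)%N} & A = [set x i | i in 'I_r].
Proof.
case: r / e; exists enum_val; last first.
  apply/setP => y; apply/idP/imsetP => [yA|[i _ ->]]; last exact: enum_valP.
  by exists (enum_rank_in yA y); rewrite // enum_rankK_in.
move=> i j ij; have szA : size (enum A) = #|A| by rewrite -cardE.
have [x0 _] : exists x0 : 'I_N, x0 \in A by exists (enum_val i); apply: enum_valP.
rewrite (enum_val_nth x0 i) (enum_val_nth x0 j).
have : sorted ltn (map val (enum A)).
  rewrite /enum_mem sorted_map; apply: (sorted_filter (leT := relpre val ltn)).
    by move=> ? ? ? /=; apply: ltn_trans.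
  by rewrite -sorted_map -enumT val_enum_ord iota_ltn_sorted.
move=> /(sorted_ltn_nth ltn_trans 0%N) /(_ i j).
by rewrite !inE size_map szA !ltn_ord !(nth_map x0) ?szA // => ->.
Qed.

Definition seg N m : {set 'I_N} := [set x : 'I_N | (x < m)%N].

Lemma card_seg N m : (m <= N)%N -> #|seg N m| = m.
Proof.
move=> mN.
have w_inj : injective (widen_ord mN) by move=> i j /(congr1 val) /= /val_inj.
rewrite -[RHS]card_ord -(card_imset _ w_inj).
apply: eq_card => x; rewrite inE; apply/idP/imsetP => [xm|[i _ ->]]; last exact: (ltn_ord i).
by exists (Ordinal xm) => //; apply: val_inj.
Qed.

Lemma prod_seg N m (F : nat -> rat) : (m <= N)%N ->
  \prod_(x in seg N m) F x = \prod_(0 <= i < m) F i.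
Proof.
move=> mN; rewrite big_mkord (big_ord_widen _ F mN); apply: eq_bigl => x.
by rewrite inE.
Qed.

(** Each difference between an element of [B] and one of [L :\: B] occurs once in
[vdm L] and once in the product on the right; each difference within [B] occurs
twice on both sides. *)
Lemma vdm_setD N (L B : {set 'I_N}) : B \subset L ->
  vdm L * vdm B =
  vdm (L :\: B) * \prod_(b in B) \prod_(x in L | x != b) `|x%:R - b%:R|.
Proof.
move=> sBL.
(* Padding with factors 1 turns the products over ordered pairs into products
   over rectangles, which split along [L = B :|: (L :\: B)]. *)
pose g (x y : 'I_N) : rat := if (x < y)%N then y%:R - x%:R else 1.
have vE A : vdm A = \prod_(x in A) \prod_(y in A) g x y.
  by apply: eq_bigr => x _; rewrite big_mkcondr.
have UD : L = B :|: (L :\: B) by rewrite -{1}(setID L B) (setIidPr sBL).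
have dBD : [disjoint B & L :\: B] by rewrite disjoints_subset setCD subsetUr.
have splitP (F : 'I_N -> rat) :
    \prod_(x in L) F x = \prod_(x in B) F x * \prod_(x in L :\: B) F x.
  by rewrite {1}UD -bigU //=; apply: eq_bigl => x; rewrite !inE.
have -> : \prod_(b in B) \prod_(x in L | x != b) `|x%:R - b%:R| =
   \prod_(b in B) \prod_(x in L) (g b x * g x b).
  apply: eq_bigr => b _; rewrite big_mkcondr; apply: eq_bigr => x _; rewrite /g.
  have [->|nxb] := eqVneq x b; first by rewrite ltnn mulr1.
  case: (ltngtP b x) => [h|h|/val_inj e]; last by rewrite e eqxx in nxb.
    by rewrite mulr1 ger0_norm // subr_ge0 ler_nat ltnW.
  by rewrite mul1r ler0_norm ?opprB // subr_le0 ler_nat ltnW.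
rewrite !vE.
have -> : \prod_(x in L) \prod_(y in L) g x y =
    (\prod_(x in B) \prod_(y in B) g x y *
     \prod_(x in B) \prod_(y in L :\: B) g x y) *
    (\prod_(x in L :\: B) \prod_(y in B) g x y *
     \prod_(x in L :\: B) \prod_(y in L :\: B) g x y).
  by rewrite splitP -!big_split /=; congr (_ * _); apply: eq_bigr => x _; rewrite splitP.
rewrite [X in _ = _ * X](eq_bigr (fun b => \prod_(x in B) g b x *
  \prod_(x in B) g x b * (\prod_(x in L :\: B) g b x * \prod_(x in L :\: B) g x b)));
  last by move=> b _; rewrite splitP !big_split.
rewrite !big_split /=.
rewrite [\prod_(b in B) \prod_(x in B) g x b]exchange_big /=.
rewrite [\prod_(b in B) \prod_(x in L :\: B) g x b]exchange_big /=.
ring.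
Qed.

Lemma prod_dist_seg N m (b : 'I_N) : (m <= N)%N -> (b < m)%N ->
  \prod_(x in seg N m | x != b) `|x%:R - b%:R| = (b`! * (m.-1 - b)`!)%:R :> rat.
Proof.
move=> mN bm; rewrite big_mkcondr.
rewrite (@prod_seg N m (fun x => if x != b :> nat then `|x%:R - b%:R| else 1)) //.
rewrite (@big_cat_nat _ _ _ b.+1) //= big_nat_recr //= eqxx mulr1.
have fr k : (\prod_(0 <= i < k) i.+1%:R : rat) = k`!%:R.
  by rewrite -natr_prod fact_prod big_add1.
rewrite natrM -!fr; congr (_ * _).
  rewrite [RHS]big_nat_rev add0n; apply: eq_big_nat => i /andP[_ ib].
  rewrite neq_ltn ib /= ler0_norm ?subr_le0 ?ler_nat 1?ltnW // opprB.
  by rewrite -natrB 1?ltnW //; congr _%:R; lia.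
rewrite -{1}[b.+1]add0n big_addn (_ : m - b.+1 = m.-1 - b)%N; last lia.
apply: eq_big_nat => i _; have bi : (b < i + b.+1)%N by lia.
rewrite neq_ltn bi orbT ger0_norm ?subr_ge0 ?ler_nat 1?ltnW //.
by rewrite -natrB 1?ltnW //; congr _%:R; lia.
Qed.

Definition superfact m : rat := \prod_(0 <= i < m) i`!%:R.

Lemma superfactS m : superfact m.+1 = superfact m * m`!%:R.
Proof. by rewrite /superfact big_nat_recr. Qed.

Lemma superfact_gt0 m : 0 < superfact m.
Proof. by apply: prodr_gt0 => i _; rewrite ltr0n fact_gt0. Qed.

Lemma vdm_seg N m : (m <= N)%N -> vdm (seg N m) = superfact m.
Proof.
move=> mN; rewrite /vdm.
rewrite (exchange_big_dep (mem (seg N m))) /=; last by move=> ? ? _ /andP[].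
rewrite /superfact -(prod_seg (fun i => i`!%:R) mN); apply: eq_bigr => y.
rewrite inE => ym.
rewrite (eq_bigl (fun x => x \in seg N y)); last first.
  by move=> x; rewrite !inE; case: (ltnP x y) => h; rewrite ?andbF // andbT (ltn_trans h).
rewrite (@prod_seg N y (fun x => y%:R - x%:R)); last exact: ltnW (leq_trans ym mN).
rewrite big_nat_rev add0n fact_prod natr_prod big_add1 /=.
apply: eq_big_nat => i /andP[_ iy]; rewrite -natrB; last lia.
by congr _%:R; lia.
Qed.

Lemma vdm_set0 N : vdm (set0 : {set 'I_N}) = 1.
Proof. by rewrite /vdm big_set0. Qed.

Lemma vdm_gt0 N (A : {set 'I_N}) : 0 < vdm A.
Proof.
apply: prodr_gt0 => x _; apply: prodr_gt0 => y /andP[_ xy].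
by rewrite subr_gt0 ltr_nat.
Qed.

Lemma vdm_imset_mono M N (f : 'I_M -> 'I_N) (L : {set 'I_M}) :
  (forall i, f i = i :> nat) -> vdm (f @: L) = vdm L.
Proof.
move=> fE; have f_inj : injective f.
  by move=> i j /(congr1 val) /=; rewrite !fE => /val_inj.
rewrite /vdm (big_imset _ (in2W f_inj)) /=; apply: eq_bigr => i _.
rewrite big_mkcondr (big_imset _ (in2W f_inj)) -big_mkcondr.
by apply: eq_big => j; rewrite /= !fE.
Qed.

(** * One step between neighbouring diagonals *)

(** Since [nb] is monotone, an injective choice is increasing and its product of
differences is the difference product of its image; a choice that is not
injective has product zero.  The sum over matchings thus becomes a sum over
all functions. *)
Lemma sum_monotone_choices N r (nb : 'I_r -> 'I_N -> bool) (w : 'I_N -> rat) :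
  (forall (i j : 'I_r) (x y : 'I_N), (i < j)%N -> nb i x -> nb j y -> (x <= y)%N) ->
  \sum_(h : {ffun 'I_r -> 'I_N} | injectiveb h && [forall i, nb i (h i)])
     vdm [set h i | i in 'I_r] * \prod_(b in [set h i | i in 'I_r]) w b =
  \sum_(h : {ffun 'I_r -> 'I_N}) \prod_i ((nb i (h i))%:R * w (h i)) *
     \prod_(i < r) \prod_(j < r | (i < j)%N) ((h j)%:R - (h i)%:R).
Proof.
move=> mono; rewrite big_mkcond; apply: eq_bigr => h _.
have [/forallP nbh|/forallPn[i ni]] := boolP [forall i, nb i (h i)]; last first.
  by rewrite andbF (bigD1 i) //= (negbTE ni) !mul0r.
rewrite andbT; case: injectiveP => [h_inj|].
  rewrite big_imset /=; last by move=> i j _ _; apply: h_inj.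
  rewrite vdm_imset; last first.
    move=> i j ij; have := mono _ _ _ _ ij (nbh i) (nbh j).
    rewrite leq_eqVlt => /orP[/eqP/val_inj/h_inj e|//].
    by rewrite e ltnn in ij.
  rewrite mulrC; congr (_ * _); apply: eq_bigr => i _.
  by rewrite nbh mul1r.
move=> ninj; suff /existsP[i /existsP[j /andP[ij /eqP e]]] :
    [exists i : 'I_r, exists j : 'I_r, (i < j)%N && (h i == h j)].
  by rewrite [X in _ * X](bigD1 i) //= [X in _ * (X * _)](bigD1 j) //= e subrr !(mul0r, mulr0).
apply: contra_notT ninj => /existsPn nex x y exy.
apply/val_inj; case: (ltngtP x y) => // xy.
  by have /existsPn /(_ y) := nex x; rewrite xy exy eqxx.
by have /existsPn /(_ x) := nex y; rewrite xy exy eqxx.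
Qed.

(** On the longer of two neighbouring diagonals, position [p] of the shorter one
touches positions [p] and [p + 1]. *)
Definition nb_up (p q : nat) := (q == p) || (q == p.+1).
(** Position [p] of the longer diagonal touches positions [p - 1] and [p] of the
shorter one, as far as they exist. *)
Definition nb_down (p q : nat) := (q == p) || (q.+1 == p).

Lemma sum_vdm_up N r (a : 'I_r -> 'I_N) :
  {homo a : i j / (i < j)%N} -> (forall i, ((a i).+1 < N)%N) ->
  \sum_(h : {ffun 'I_r -> 'I_N} | injectiveb h && [forall i, nb_up (a i) (h i)])
     vdm [set h i | i in 'I_r] = 2 ^+ r * vdm [set a i | i in 'I_r].
Proof.
move=> ah aN.
rewrite (eq_bigr (fun h : {ffun 'I_r -> 'I_N} =>
    vdm [set h i | i in 'I_r] * \prod_(b in [set h i | i in 'I_r]) 1)); last first.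
  by move=> h _; rewrite big1 ?mulr1.
rewrite (sum_monotone_choices (nb := fun i q => nb_up (a i) q) (fun=> 1)); last first.
  move=> i j x y /ah aij; rewrite /nb_up => /orP[] /eqP -> /orP[] /eqP ->; lia.
rewrite (@sum_choice_vandermonde_poly _ 'I_N _ (fun i q => (nb_up (a i) q)%:R * 1)
  (fun q => q%:R) (fun=> 1) (fun i => (a i)%:R) (fun j => 'X^j + ('X + 1) ^+ j)).
- rewrite big1 // mul1r vdm_imset //; congr (_ * _).
  rewrite (eq_bigr (fun=> 2)); first by rewrite prodr_const card_ord.
  by move=> j _; have [_ ->] := vandermonde_step_up rat j.
- by move=> j; have [] := vandermonde_step_up rat j.
- move=> i j; rewrite mul1r !hornerE.
  rewrite (bigD1 (a i)) //= (bigD1 (Ordinal (aN i))) /=; last first.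
    by rewrite -val_eqE /= neq_ltn ltnSn orbT.
  rewrite big1 ?addr0; last first.
    move=> q; rewrite -!val_eqE /= => /andP[q1 q2].
    by rewrite /nb_up (negbTE q1) (negbTE q2) !mul0r.
  by rewrite /nb_up !eqxx orbT !mul1r -natr1.
Qed.

(** By [prod_dist_seg] this is the inverse of the product of the distances from [b]
to the other elements of an interval of [m + 1] positions. *)
Definition seg_weight m (b : nat) : rat := ((b`! * (m - b)`!)%:R)^-1.

(** The two neighbours of [u] have weights proportional to [u] and [n - u], which
vanish exactly when the corresponding neighbour does not exist; so the ends of
the diagonal need no separate treatment. *)
Lemma sum_vdm_down N n r (a : 'I_r -> 'I_N) :
  {homo a : i j / (i < j)%N} -> (forall i, (a i <= n)%N) -> (r <= n)%N -> (n <= N)%N ->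
  \sum_(h : {ffun 'I_r -> 'I_N} |
        injectiveb h && [forall i, (h i < n)%N && nb_down (a i) (h i)])
     vdm [set h i | i in 'I_r] * \prod_(b in [set h i | i in 'I_r]) seg_weight n.-1 b =
  (n`!%:R / (n - r)`!%:R) *
    (vdm [set a i | i in 'I_r] * \prod_(b in [set a i | i in 'I_r]) seg_weight n b).
Proof.
move=> ah an rn nN.
have a_inj := homo_ltn_inj ah.
rewrite (sum_monotone_choices (nb := fun i q => (q < n)%N && nb_down (a i) q) (fun b => seg_weight n.-1 b)); last first.
  move=> i j x y /ah aij /andP[_ xi] /andP[_ yj]; move: xi yj.
  by rewrite /nb_down => /orP[] /eqP h1 /orP[] /eqP h2; lia.
rewrite (@sum_choice_vandermonde_poly _ 'I_N _
  (fun i q => ((q < n)%N && nb_down (a i) q)%:R * seg_weight n.-1 q)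
  (fun q => q%:R) (fun i => seg_weight n (a i)) (fun i => (a i)%:R)
  (fun j => 'X * ('X - 1) ^+ j + (n%:R%:P - 'X) * 'X^j)).
- rewrite vdm_imset // (big_imset _ (in2W a_inj)) /=.
  rewrite [X in _ * X * _ = _](_ : _ = n`!%:R / (n - r)`!%:R); first by ring.
  rewrite (eq_bigr (fun j : 'I_r => (n - j)%:R)); last first.
    move=> j _; have [_ ->] := vandermonde_step_down rat n j.
    by rewrite natrB // ltnW // (leq_trans (ltn_ord j)).
  rewrite -natr_prod -ffact_prod -(ffact_fact rn) natrM mulfK //.
  by rewrite pnatr_eq0 -lt0n fact_gt0.
- by move=> j; have [] := vandermonde_step_down rat n j.
- move=> i j; rewrite !hornerE; set u := a i.
  have un := an i : (u <= n)%N.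
  have f_neq0 x : x`!%:R != 0 :> rat by rewrite pnatr_eq0 -lt0n fact_gt0.
  have E1 : \sum_(q : 'I_N | q == u) ((q < n)%N && nb_down u q)%:R * seg_weight n.-1 q * q%:R ^+ j
     = seg_weight n u * ((n%:R - u%:R) * u%:R ^+ j).
    rewrite big_pred1_eq /nb_down eqxx /= andbT /seg_weight.
    have [ltun|] := ltnP u n; last first.
      by move=> geun; rewrite (_ : n%:R = u%:R :> rat) ?subrr ?mul0r ?mulr0 //; congr _%:R; lia.
    rewrite mul1r -natrB 1?ltnW // (_ : (n - u = (n.-1 - u).+1)%N); last lia.
    have s0 : (n.-1 - u).+1%:R != 0 :> rat by rewrite pnatr_eq0.
    by rewrite factS !natrM; field; rewrite nat1r !f_neq0 s0.
  have E2 : \sum_(q : 'I_N | q != u) ((q < n)%N && nb_down u q)%:R * seg_weight n.-1 q * q%:R ^+ j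
     = seg_weight n u * (u%:R * (u%:R - 1) ^+ j).
    case: (posnP u) => [u0|upos].
      rewrite u0 mul0r mulr0 big1 // => q; rewrite -val_eqE /= u0 => qu.
      by rewrite /nb_down (negbTE qu) /= andbF !mul0r.
    have vN : (u.-1 < N)%N by lia.
    rewrite (bigD1 (Ordinal vN)) /=; last by rewrite -val_eqE /=; lia.
    rewrite big1 ?addr0; last first.
      move=> q; rewrite -!val_eqE /= => /andP[q1 q2].
      rewrite /nb_down (negbTE q1) (_ : (q.+1 == u) = false) ?andbF ?mul0r //; lia.
    rewrite /nb_down prednK // eqxx orbT andbT un.
    rewrite mul1r /seg_weight (_ : (n.-1 - u.-1 = n - u)%N); last lia.
    rewrite -[in u`!](prednK upos) factS (prednK upos).
    rewrite (_ : u.-1%:R = u%:R - 1 :> rat); last by rewrite -[in RHS](prednK upos) -natr1 addrK.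
    have s0 : u%:R != 0 :> rat by rewrite pnatr_eq0 -lt0n.
    by rewrite !natrM; field; rewrite ?s0 !f_neq0 ?s0 ?natrM ?mulf_neq0 ?f_neq0 // ?s0.
  by rewrite (bigID (fun q => q == u)) /= E1 E2 -mulrDr addrC.
Qed.

(** * Tilings of half a diamond with prescribed spine squares *)

Lemma vdm_segD N m (B : {set 'I_N}) : (m <= N)%N -> B \subset seg N m ->
  vdm (seg N m :\: B) = superfact m * (vdm B * \prod_(b in B) seg_weight m.-1 b).
Proof.
move=> mN sB; have := vdm_setD sB; rewrite vdm_seg // mulrA => ->.
rewrite -mulrA -big_split /= big1 ?mulr1 // => b bB.
have bm : (b < m)%N by have := subsetP sB b bB; rewrite inE.
by rewrite prod_dist_seg // /seg_weight mulfV // pnatr_eq0 muln_eq0 negb_or -!lt0n !fact_gt0.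
Qed.

(** The diagonals parallel to the spine are numbered from the outermost one, 0, to
the spine, [n]; their lengths alternate between [n] and [n + 1]. *)
Definition layer n (D : nat) : {set 'I_n.+1} := seg n.+1 (n + odd D).

Definition layer_nb (D p q : nat) : bool :=
  if odd D then nb_up p q else nb_down p q.

(** The number of tilings of the diagonals outside [D] together with the squares [A]
of diagonal [D].  On the longer diagonals the difference product is that of the
squares left out. *)
Definition half_count n D (A : {set 'I_n.+1}) : rat :=
  let m := uphalf D in
  let S := if odd D then layer n D :\: A else A in
  if #|S| == m then 2 ^+ 'C(D./2.+1, 2) * vdm S / superfact m else 0.

(** For odd [D] this is [sum_vdm_up].  For even [D] the counts are expressed through
complements by [vdm_segD], on both sides of [sum_vdm_down]. *)
Lemma half_count_step n D r (x : 'I_r -> 'I_n.+1) : (D < n)%N ->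
  {homo x : i j / (i < j)%N} ->
  (forall i, x i \in layer n D.+1) ->
  \sum_(h : {ffun 'I_r -> 'I_n.+1} |
      injectiveb h && [forall i, (h i \in layer n D) && layer_nb D (x i) (h i)])
     half_count D (layer n D :\: [set h i | i in 'I_r]) =
  half_count D.+1 [set x i | i in 'I_r].
Proof.
move=> Dn xh xL.
have x_inj := homo_ltn_inj xh.
have layN E : (n + odd E <= n.+1)%N by case: odd; rewrite ?addn1 ?addn0.
pose m := D./2.
have mD : D = (odd D + m.*2)%N by rewrite odd_double_half.
case oD : (odd D) mD => /= mD; last first.
- rewrite add0n in mD.
  have lD : layer n D = seg n.+1 n by rewrite /layer oD addn0.
  have lD1 : layer n D.+1 = seg n.+1 n.+1 by rewrite /layer /= oD addn1.
  have uD : uphalf D = m by rewrite mD uphalf_double.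
  have uD1 : uphalf D.+1 = m.+1 by rewrite /= -/m.
  have hD1 : D.+1./2 = m by rewrite -uD.
  have hD : D./2 = m by [].
  rewrite /half_count oD /= -/m /layer_nb oD lD lD1 uD.
  have cA : #|seg n.+1 n.+1 :\: [set x i | i in 'I_r]| = (n.+1 - r)%N.
    rewrite cardsD card_seg // (setIidPr _); last first.
      by apply/subsetP => y _; rewrite inE ltn_ord.
    by rewrite card_imset // card_ord.
  have hI (h : {ffun 'I_r -> 'I_n.+1}) : injectiveb h &&
      [forall i, (h i \in seg n.+1 n) && nb_down (x i) (h i)] ->
      [set h i | i in 'I_r] \subset seg n.+1 n /\ #|[set h i | i in 'I_r]| = r.
    move=> /andP[/injectiveP h_inj /forallP hP]; split.
      by apply/subsetP => _ /imsetP[i _ ->]; have /andP[] := hP i.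
    by rewrite card_imset // card_ord.
  have cH (h : {ffun 'I_r -> 'I_n.+1}) : injectiveb h &&
      [forall i, (h i \in seg n.+1 n) && nb_down (x i) (h i)] ->
      (#|seg n.+1 n :\: [set h i | i in 'I_r]| == m) = (n.+1 - r == m.+1)%N.
    move=> /hI[sh ch]; have := subset_leq_card sh.
    rewrite cardsD (setIidPr sh) card_seg // ch; lia.
  rewrite cA; case: eqP => nr; last first.
    by rewrite big1 // => h /cH ->; case: eqP.
  have rn : r = (n - m)%N by lia.
  have nrm : (n - r)%N = m by lia.
  rewrite (eq_bigr (fun h : {ffun 'I_r -> 'I_n.+1} =>
      (2 ^+ 'C(m.+1, 2) * superfact n / superfact m) * (vdm [set h i | i in 'I_r] *
      \prod_(b in [set h i | i in 'I_r]) seg_weight n.-1 b))); last first.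
    move=> h hP; rewrite cH // nr eqxx vdm_segD //; last by have [] := hI _ hP.
    by rewrite mulrA mulrAC.
  rewrite -big_distrr /=.
  rewrite (eq_bigl (fun h : {ffun 'I_r -> 'I_n.+1} => injectiveb h &&
     [forall i, (h i < n)%N && nb_down (x i) (h i)])); last first.
    by move=> h; congr (_ && _); apply: eq_forallb => i; rewrite inE.
  rewrite sum_vdm_down //; last 2 first.
  + by move=> i; rewrite -ltnS.
  + by rewrite rn leq_subr.
  rewrite nrm vdm_segD //; last by apply/subsetP => y _; rewrite inE ltn_ord.
  rewrite !superfactS /=; field.
  rewrite pnatr_eq0 -lt0n fact_gt0 /=; apply: lt0r_neq0; exact: superfact_gt0.
rewrite add1n in mD.
have lD : layer n D = seg n.+1 n.+1 by rewrite /layer oD addn1.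
have lD1 : layer n D.+1 = seg n.+1 n by rewrite /layer /= oD addn0.
have uD : uphalf D = m.+1 by rewrite mD /= doubleK.
rewrite /half_count oD /= -/m /layer_nb oD lD lD1 uD -/m.
have sh (h : {ffun 'I_r -> 'I_n.+1}) :
   seg n.+1 n.+1 :\: (seg n.+1 n.+1 :\: [set h i | i in 'I_r]) = [set h i | i in 'I_r].
  by apply/setP => y; rewrite !inE ltn_ord andbT negb_and negbK orbF.
rewrite card_imset // card_ord.
have [rm|rm] := eqVneq r m.+1; last first.
  rewrite big1 // => h /andP[/injectiveP h_inj _].
  by rewrite sh card_imset // card_ord (negbTE rm).
rewrite (eq_bigr (fun h : {ffun 'I_r -> 'I_n.+1} =>
      (2 ^+ 'C(m.+1, 2) / superfact m.+1) * vdm [set h i | i in 'I_r])); last first.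
  move=> h /andP[/injectiveP h_inj _].
  by rewrite sh card_imset // card_ord (introT eqP rm) mulrAC.
rewrite -big_distrr /=.
rewrite (eq_bigl (fun h : {ffun 'I_r -> 'I_n.+1} => injectiveb h &&
     [forall i, nb_up (x i) (h i)])); last first.
  by move=> h; congr (_ && _); apply: eq_forallb => i; rewrite inE ltn_ord.
rewrite sum_vdm_up //; last by move=> i; have := xL i; rewrite lD1 inE ltnS.
rewrite [X in _ * (_ ^+ X * _)]rm (binS m.+1) bin1 exprD; ring.
Qed.

Section HalfAztec.
Variables (n : nat) (T : finType) (c : nat -> 'I_n.+1 -> T).
Hypothesis c_inj : forall D D' p q, (D <= n)%N -> (D' <= n)%N ->
  p \in layer n D -> q \in layer n D' -> c D p = c D' q -> D = D' /\ p = q.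

Definition region D : {set T} := \bigcup_(E < D) [set c E p | p in layer n E].

Lemma regionP D y :
  reflect (exists E p, [/\ (E < D)%N, p \in layer n E & y = c E p]) (y \in region D).
Proof.
apply: (iffP bigcupP) => [[E _ /imsetP[p pL ->]]|[E [p [ED pL ->]]]].
  by exists (E : nat), p.
by exists (Ordinal ED) => //; apply: imset_f.
Qed.

(** The function [c] gives the square at each position of each diagonal.  Leaving it
abstract lets the two halves of the diamond be treated at once. *)
Lemma region_covers (K : {set {set T}}) D (A : {set 'I_n.+1}) : (D <= n)%N ->
  A \subset layer n D ->
  (forall B : {set T}, B \subset region D :|: [set c D p | p in A] ->
     B \in K <-> exists E p q, [/\ (E < D)%N, p \in layer n E.+1, q \in layer n E,
        layer_nb E p q & B = [set c E.+1 p; c E q]]) ->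
  (covers K (region D :|: [set c D p | p in A]))%:R = half_count D A.
Proof.
elim: D A => [|D IH] A Dn sA KP.
  have r0 : region 0 = set0 by rewrite /region big_ord0.
  rewrite /half_count /= /superfact big_geq // divr1.
  rewrite (bin_small (leqnn _)) expr0 mul1r cards_eq0.
  have [->|/set0Pn[p pA]] := eqVneq A set0.
    by rewrite imset0 r0 setU0 covers0 vdm_set0.
  rewrite (@covers_eq0 _ _ _ (c 0 p)) //; first by rewrite inE imset_f ?orbT.
  by move=> B sB /(KP _ sB) [E [? [? []]]].
(* Peel off the squares [A] of diagonal [D.+1]; what remains is the region outside
   diagonal [D] and the squares of diagonal [D] that were not used. *)
have [x xh eA] := vdm_enum (erefl #|A|).
set r := #|A| in x xh eA *.
have x_inj := homo_ltn_inj xh.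
have xA i : x i \in A by rewrite eA imset_f.
have xL i : x i \in layer n D.+1 by apply: (subsetP sA).
set X := region D.+1 :|: _.
have DDn : (D <= n)%N by apply: ltnW.
have peel := @covers_peel T 'I_r 'I_n.+1 (fun i => c D.+1 (x i)) (c D) (layer n D)
  (fun i q => layer_nb D (x i) q) K.
have cX q : q \in layer n D -> c D q \in X.
  by move=> qL; rewrite inE; apply/orP; left; apply/regionP; exists D, q.
have aX i : c D.+1 (x i) \in X by rewrite inE imset_f ?orbT.
rewrite peel //; last first.
- move=> B i sB BK iB; have [E [p [q [ED pL qL nb eB]]]] := proj1 (KP _ sB) BK.
  move: iB; rewrite eB !inE => /orP[] /eqP /c_inj => /(_ Dn).
    move=> /(_ (leq_trans ED Dn) (xL i) pL) [[e1] e2]; subst E p.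
    by exists q.
  move=> /(_ (ltnW (leq_trans ED Dn)) (xL i) qL)[e1 _]; lia.
- move=> i q qL nb; apply/KP; last by exists D, (x i), q.
  by apply/subsetP => y; rewrite !in_set2 => /orP[] /eqP ->; [exact: aX|exact: cX].
- move=> i q qL; apply/negP => /eqP /c_inj => /(_ Dn DDn (xL i) qL) [e _]; lia.
- by move=> p q pL qL /c_inj => /(_ DDn DDn pL qL) [].
- by move=> i j /c_inj => /(_ Dn Dn (xL i) (xL j)) [_ /x_inj].
rewrite natr_sum.
transitivity (\sum_(h : {ffun 'I_r -> 'I_n.+1} |
      injectiveb h && [forall i, (h i \in layer n D) && layer_nb D (x i) (h i)])
     half_count D (layer n D :\: [set h i | i in 'I_r])); last first.
  by rewrite half_count_step // -eA.
apply: eq_big => // h /andP[/injectiveP h_inj /forallP hP].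
have hL i : h i \in layer n D by have /andP[] := hP i.
set A' := layer n D :\: _.
have eX : X :\: choice_set (fun i => c D.+1 (x i)) (c D) h =
    region D :|: [set c D p | p in A'].
  apply/setP => y; rewrite in_setD [in RHS]in_setU; apply/andP/orP.
    case=> ny; rewrite inE => /orP[/regionP[E [p [ED pL ey]]]|/imsetP[p pA ey]].
      move: ED; rewrite ltnS leq_eqVlt => /orP[/eqP e|ED]; last first.
        by left; apply/regionP; exists E, p.
      right; subst E; apply/imsetP; exists p => //.
      rewrite inE pL andbT; apply: contra ny => /imsetP[i _ e].
      by rewrite ey e inE; apply/orP; right; apply/imsetP; exists i.
    case/negP: ny; rewrite inE; apply/orP; left; move: pA; rewrite eA => /imsetP[i _ e].
    by apply/imsetP; exists i; rewrite // -e.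
  have notc E p : (E <= D)%N -> p \in layer n E ->
      (forall i, E = D -> p != h i) ->
      c E p \notin choice_set (fun i => c D.+1 (x i)) (c D) h.
    move=> ED pL nh; rewrite inE negb_or; apply/andP; split.
      apply/negP => /imsetP[i _] /c_inj => /(_ (leq_trans ED DDn) Dn pL (xL i)) [e _].
      lia.
    apply/negP => /imsetP[i _] /c_inj => /(_ (leq_trans ED DDn) DDn pL (hL i)) [e1 e2].
    by have := nh i e1; rewrite e2 eqxx.
  case=> [/regionP[E [p [ED pL ->]]]|/imsetP[p pA' ->]].
    split; first by apply: notc => // [|i e]; [apply: ltnW|rewrite e ltnn in ED].
    by rewrite inE; apply/orP; left; apply/regionP; exists E, p; split => //; apply: ltnW.
  move: pA'; rewrite inE => /andP[nh pL]; split; last exact: cX.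
  by apply: notc => // i _; apply: contra nh => /eqP ->; apply: imset_f.
rewrite eX; apply: IH => //; first by apply: subsetDl.
move=> B sB.
have sX : region D :|: [set c D p | p in A'] \subset X by rewrite -eX subsetDl.
split.
  move=> /(KP _ (subset_trans sB sX)) [E [p [q [ED pL qL nb eB]]]].
  exists E, p, q; split => //.
  move: ED; rewrite ltnS leq_eqVlt => /orP[/eqP e|//]; subst E.
  have : c D.+1 p \in B by rewrite eB !inE eqxx.
  move=> /(subsetP sB); rewrite inE => /orP[/regionP[E [p' [ED p'L]]]|/imsetP[p' p'A]].
    move=> /c_inj => /(_ Dn (leq_trans (ltnW ED) DDn) pL p'L) [e _]; lia.
  move: p'A; rewrite inE => /andP[_ p'L].
  move=> /c_inj => /(_ Dn DDn pL p'L) [e _]; lia.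
move=> [E [p [q [ED pL qL nb eB]]]]; apply/KP; first exact: subset_trans sB sX.
by exists E, p, q; split => //; apply: ltnW.
Qed.

End HalfAztec.

(** * Laplace expansion of a doubled Vandermonde determinant *)

Section Laplace.
Variable k : nat.
Implicit Types (al be : 'I_(k + k) -> rat) (L : {set 'I_(k + k)}).

Definition stacked al be : 'M[rat]_(k + k) :=
  col_mx (\matrix_(j < k, i < k + k) (al i * i%:R ^+ j))
         (\matrix_(j < k, i < k + k) (be i * i%:R ^+ j)).

(** The columns of [L] live in the upper block, the others in the lower block. *)
Definition sorted_mx L := stacked (fun i => (i \in L)%:R) (fun i => (i \notin L)%:R).

Lemma det_stacked_sub al be :
  \det (stacked al (fun i => be i - al i)) = \det (stacked al be).
Proof.
have -> : stacked al (fun i => be i - al i) =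
    block_mx 1%:M 0 (- 1%:M) 1%:M *m stacked al be.
  rewrite /stacked mul_block_col mul0mx addr0 !mul1mx mulNmx mul1mx; congr col_mx.
  by apply/matrixP => i j; rewrite !mxE mulrBl addrC.
by rewrite det_mulmx det_lblock !det1 !mul1r.
Qed.

(** Each column is the sum of its upper and its lower part. *)
Lemma det_stacked al be :
  \det (stacked al be) =
  \sum_(L : {set 'I_(k + k)}) (\prod_(i in L) al i * \prod_(i in ~: L) be i) * \det (sorted_mx L).
Proof.
pose F (i : 'I_(k + k)) (b : bool) (j : 'I_(k + k)) : rat :=
  match split j with
  | inl l => if b then al i * i%:R ^+ l else 0
  | inr l => if b then 0 else be i * i%:R ^+ l
  end.
have -> : stacked al be = \matrix_(j, i) \sum_b F i b j.
  apply/matrixP => j i; rewrite /stacked /F !mxE big_bool.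
  by case: split => l; rewrite !mxE /= ?addr0 ?add0r.
rewrite (det_col_sum F).
rewrite (reindex (fun L : {set 'I_(k + k)} => [ffun i => i \in L])) /=; last first.
  exists (fun h : {ffun _ -> bool} => [set i | h i]) => [L _|h _].
    by apply/setP => i; rewrite inE ffunE.
  by apply/ffunP => i; rewrite ffunE inE.
apply: eq_bigr => L _.
pose W i := if i \in L then al i else be i.
have -> : \matrix_(j, i) F i ([ffun i => i \in L] i) j =
    \matrix_(j, i) (W i * sorted_mx L j i).
  apply/matrixP => j i; rewrite !mxE /F ffunE /W.
  by case: split => l; rewrite !mxE; case: (i \in L) => /=; rewrite ?mul0r ?mulr0 ?mul1r.
rewrite (det_scale_col W (fun j i => sorted_mx L j i)); congr (_ * _); last first.
  by congr (\det _); apply/matrixP => j i; rewrite mxE.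
rewrite (bigID (mem L)) /=; congr (_ * _).
  by apply: eq_bigr => i iL; rewrite /W iL.
by apply: eq_big => i; rewrite ?inE // /W => /negbTE ->.
Qed.

(** In the Leibniz formula a permutation with a nonzero term maps the rows of the
upper block into [L] and those of the lower block into its complement. *)
Lemma det_sorted_mx_eq0 L : #|L| != k -> \det (sorted_mx L) = 0.
Proof.
move=> Lk; rewrite /determinant big1 // => s _.
have [/forallP h1|/forallPn[j nj]] := boolP [forall j : 'I_k, s (lshift k j) \in L];
  last first.
  by rewrite (bigD1 (lshift k j)) //= /sorted_mx /stacked col_mxEu mxE (negbTE nj)
    !mul0r mulr0.
have [/forallP h2|/forallPn[j nj]] := boolP [forall j : 'I_k, s (rshift k j) \notin L];
  last first.
  by rewrite (bigD1 (rshift k j)) //= /sorted_mx /stacked col_mxEd mxE (negbTE nj) !mul0r mulr0.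
have c1 : (k <= #|L|)%N.
  have inj1 : injective (fun j : 'I_k => s (lshift k j)).
    by move=> i j /perm_inj /lshift_inj.
  rewrite -{1}(card_ord k) -(card_imset _ inj1); apply: subset_leq_card.
  by apply/subsetP => _ /imsetP[j _ ->].
have c2 : (k <= #|~: L|)%N.
  have inj2 : injective (fun j : 'I_k => s (rshift k j)).
    by move=> i j /perm_inj /rshift_inj.
  rewrite -{1}(card_ord k) -(card_imset _ inj2); apply: subset_leq_card.
  by apply/subsetP => _ /imsetP[j _ ->]; rewrite inE.
have := cardsC L; rewrite card_ord => c3.
by case/eqP: Lk; lia.
Qed.

Lemma prod_sign_ltn r (x : 'I_r -> 'I_(k + k)) : {homo x : i j / (i < j)%N} ->
  \prod_(l in [set x i | i in 'I_r]) \prod_(y in [set x i | i in 'I_r])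
     (-1 : rat) ^+ (y < l)%N = \prod_(i < r) \prod_(j < r) (-1) ^+ (j < i)%N.
Proof.
move=> xh.
have x_inj := homo_ltn_inj xh.
have xm := homo_ltn_mono xh.
rewrite (big_imset _ (in2W x_inj)); apply: eq_bigr => i _.
by rewrite (big_imset _ (in2W x_inj)); apply: eq_bigr => j _; rewrite xm.
Qed.

(** The part of the sign of a Laplace term that does not depend on the chosen
columns. *)
Definition laplace_sign : rat := \prod_(i < k) \prod_(j < k) (-1) ^+ (j < i)%N.

(** Sorting the columns makes the matrix block diagonal with Vandermonde blocks.
The sign of the sorting permutation is found by applying the same permutation to
the Vandermonde matrix of all the positions and comparing signs in its product
formula; it is the parity of the number of pairs [z < l] with [l] in [L] and [z]
outside.  Counting all [z < l] instead gives [(-1) ^+ l] for each [l], and the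
pairs inside [L] contribute [laplace_sign]. *)
Lemma det_sorted_mx L : #|L| = k ->
  laplace_sign * \det (sorted_mx L) = \prod_(i in L) (-1) ^+ i * (vdm L * vdm (~: L)).
Proof.
move=> cL.
have cR : #|~: L| = k by have := cardsC L; rewrite card_ord; lia.
have [x xh eL] := vdm_enum cL.
have [y yh eR] := vdm_enum cR.
have x_inj := homo_ltn_inj xh.
have y_inj := homo_ltn_inj yh.
have xL i : x i \in L by rewrite eL imset_f.
have yL i : y i \notin L by rewrite -in_setC eR imset_f.
pose p0 (i : 'I_(k + k)) := match split i with inl l => x l | inr l => y l end.
have p0l i : p0 (lshift k i) = x i by rewrite /p0 (unsplitK (inl _ i)).
have p0r i : p0 (rshift k i) = y i by rewrite /p0 (unsplitK (inr _ i)).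
have p0_inj : injective p0.
  move=> i j; case: (split_ordP i) => i' ->; case: (split_ordP j) => j' ->;
    rewrite ?p0l ?p0r.
  - by move=> /x_inj ->.
  - by move=> e; have := xL i'; rewrite e (negbTE (yL _)).
  - by move=> e; have := xL j'; rewrite -e (negbTE (yL _)).
  - by move=> /y_inj ->.
pose s := perm p0_inj.
have detp (A : 'M[rat]_(k + k)) : \det (col_perm s A) = \det A * (-1) ^+ s.
  by rewrite col_permE det_mulmx det_perm odd_permV.
have E1 : \det (sorted_mx L) * (-1) ^+ s = vdm L * vdm (~: L).
  rewrite -detp.
  have -> : col_perm s (sorted_mx L) =
      block_mx (Vandermonde k (\row_i (x i)%:R)) 0 0 (Vandermonde k (\row_i (y i)%:R)).
    apply/matrixP => i j; rewrite mxE permE.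
    case: (split_ordP i) => i' ->; case: (split_ordP j) => j' ->; rewrite ?p0l ?p0r.
    - by rewrite block_mxEul col_mxEu !mxE xL mul1r.
    - by rewrite block_mxEur col_mxEu !mxE (negbTE (yL _)) mul0r.
    - by rewrite block_mxEdl col_mxEd !mxE xL mul0r.
    - by rewrite block_mxEdr col_mxEd !mxE yL mul1r.
  rewrite det_ublock !det_Vandermonde eL -eL eR eL !vdm_imset //.
  by congr (_ * _); apply: eq_bigr => i _; apply: eq_bigr => j _; rewrite !mxE.
(* The product formula for the permuted points: the pairs inside [L], those
   inside the complement, and the mixed pairs, which may be out of order. *)
have E2 : vdm [set: 'I_(k + k)] * (-1) ^+ s =
   vdm L * vdm (~: L) * \prod_(l in L) \prod_(z in ~: L) (z%:R - l%:R).
  pose V := Vandermonde (k + k) (\row_(i < k + k) (i%:R : rat)).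
  have := detp V.
  have -> : col_perm s V = Vandermonde (k + k) (\row_i (p0 i)%:R).
    by apply/matrixP => i j; rewrite !mxE permE.
  rewrite !det_Vandermonde => e.
  have -> : vdm [set: 'I_(k + k)] = \prod_(i < k + k) \prod_(j < k + k | (i < j)%N)
      ((\row_i0 (i0%:R : rat)) 0 j - (\row_i0 i0%:R) 0 i).
    rewrite /vdm; apply: eq_big => i; rewrite ?inE // => _.
    by apply: eq_big => j; rewrite ?inE // => _; rewrite !mxE.
  rewrite -e big_split_ord /=.
  rewrite (eq_bigr (fun i : 'I_k => \prod_(j < k | (i < j)%N) ((x j)%:R - (x i)%:R) *
    \prod_(j < k) ((y j)%:R - (x i)%:R))); last first.
    move=> i _; rewrite big_split_ord /=; congr (_ * _).
      by apply: eq_bigr => j _; rewrite !mxE !p0l.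
    by apply: eq_big => j; rewrite ?(leq_trans (ltn_ord i)) ?leq_addr // => _; rewrite !mxE p0l p0r.
  rewrite big_split /=.
  rewrite [X in _ * X = _](eq_bigr (fun i : 'I_k => \prod_(j < k | (i < j)%N) ((y j)%:R - (y i)%:R)));
    last first.
    move=> i _; rewrite big_split_ord /= big1 ?mul1r; last first.
      by move=> j; have := ltn_ord j; lia.
    by apply: eq_big => j; rewrite ?ltn_add2l // => _; rewrite !mxE !p0r.
  rewrite -!vdm_imset // -eL -eR.
  rewrite [in RHS]eL (big_imset _ (in2W x_inj)) /= -eL.
  rewrite (eq_bigr (fun i => \prod_(z in ~: L) (z%:R - (x i)%:R))); first by ring.
  by move=> i _; rewrite [in RHS]eR (big_imset _ (in2W y_inj)).
have E3 : (-1) ^+ s = \prod_(l in L) \prod_(z in ~: L) (-1) ^+ (z < l)%N :> rat.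
  have := congr1 Num.sg E2; rewrite !sgrM !(gtr0_sg (vdm_gt0 _)) !mul1r sgrX sgrN1 => ->.
  rewrite (big_morph _ (@sgrM _) (@sgr1 _)); apply: eq_bigr => l lL.
  rewrite (big_morph _ (@sgrM _) (@sgr1 _)); apply: eq_bigr => z zL.
  have nzl : z != l by apply: contraTneq zL => ->; rewrite inE lL.
  case: (ltngtP z l) => [h|h|/val_inj e]; last by rewrite e eqxx in nzl.
    by rewrite ltr0_sg // subr_lt0 ltr_nat.
  by rewrite gtr0_sg // subr_gt0 ltr_nat.
(* Every [l] in [L] exceeds exactly [l] positions, some in [L], some outside. *)
have E4 : laplace_sign * (-1) ^+ s = \prod_(l in L) (-1) ^+ l.
  rewrite E3 /laplace_sign -(prod_sign_ltn xh) -eL -big_split; apply: eq_bigr => l _ /=.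
  have -> : \prod_(y0 in L) (-1) ^+ (y0 < l)%N * \prod_(z in ~: L) (-1) ^+ (z < l)%N =
      \prod_(z < k + k) (-1) ^+ (z < l)%N :> rat.
    rewrite [RHS](bigID (mem L)) /=; congr (_ * _).
    by apply: eq_bigl => z; rewrite inE.
  rewrite (eq_bigr (fun z : 'I_(k + k) => if (z < l)%N then (-1 : rat) else 1)); last first.
    by move=> z _; case: ltnP.
  rewrite -big_mkcond /= prodr_const; congr (_ ^+ _).
  rewrite -[RHS](@card_seg (k + k) l) 1?ltnW //; apply: eq_card => z.
  by rewrite !inE.
by rewrite -E4 -E1 -!mulrA; congr (_ * _); rewrite mulrCA -expr2 sqrr_sign mulr1.
Qed.

Definition vdm_pairing al be : rat :=
  \sum_(L : {set 'I_(k + k)} | #|L| == k)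
     (\prod_(i in L) ((-1) ^+ i * al i) * \prod_(i in ~: L) be i) * (vdm L * vdm (~: L)).

Lemma vdm_pairingE al be : vdm_pairing al be = laplace_sign * \det (stacked al be).
Proof.
rewrite det_stacked big_distrr /= /vdm_pairing big_mkcond /=; apply: eq_bigr => L _.
have [cL|cL] := eqVneq; last by rewrite det_sorted_mx_eq0 // !mulr0.
by rewrite [RHS]mulrCA det_sorted_mx // big_split /=; ring.
Qed.

(** This is the subtraction of the upper block from the lower one in the determinant
that the pairing expands. *)
Lemma vdm_pairing_sub al be :
  vdm_pairing al be = vdm_pairing al (fun i => be i - al i).
Proof. by rewrite !vdm_pairingE det_stacked_sub. Qed.

End Laplace.

(** * Difference products of complementary sets with prescribed odd elements *)

Definition parity_class k (e : bool) : {set 'I_(k + k)} := [set i : 'I_(k + k) | odd i == e].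

Lemma parity_classE k (e : bool) : exists2 x : 'I_k -> 'I_(k + k),
  (forall i, x i = (e + i.*2)%N :> nat) & parity_class k e = [set x i | i in 'I_k].
Proof.
have xP (i : 'I_k) : (e + i.*2 < k + k)%N by have := ltn_ord i; lia.
exists (fun i => Ordinal (xP i)) => //; apply/setP => y; rewrite inE.
apply/eqP/imsetP => [ye|[i _ ->] /=]; last by rewrite oddD odd_double; case: e {xP}.
have yk : (y./2 < k)%N by have := ltn_ord y; lia.
by exists (Ordinal yk) => //; apply: val_inj; rewrite /= -ye odd_double_half.
Qed.

Lemma card_parity_class k e : #|parity_class k e| = k.
Proof.
have [x xE ->] := parity_classE k e; rewrite card_imset ?card_ord //.
by move=> i j /(congr1 val) /=; rewrite !xE => ?; apply: val_inj => /=; lia.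
Qed.

Lemma vdm_parity_class k e : vdm (parity_class k e) = 2 ^+ 'C(k, 2) * superfact k.
Proof.
have [x xE ->] := parity_classE k e.
rewrite vdm_imset; last by move=> i j ij; rewrite !xE; lia.
rewrite -(vdm_seg (leqnn k)).
have -> : vdm (seg k k) = \prod_(i < k) \prod_(j < k | (i < j)%N) (j%:R - i%:R).
  apply: eq_big => i; rewrite ?inE ?ltn_ord // => _.
  by apply: eq_bigl => j; rewrite inE ltn_ord.
have -> : 2 ^+ 'C(k, 2) = \prod_(i < k) \prod_(j < k | (i < j)%N) (2 : rat).
  rewrite (exchange_big_dep xpredT) //= -bin2_sum big_mkord -prodrXr.
  apply: eq_bigr => j _; rewrite prodr_const; congr (_ ^+ _).
  rewrite -[LHS](@card_seg k j) 1?ltnW //; apply: eq_card => i.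
  by rewrite !inE.
rewrite -big_split; apply: eq_bigr => i _ /=.
by rewrite -big_split; apply: eq_bigr => j _; rewrite /= !xE -!muln2 !natrD !natrM; ring.
Qed.

(** Take the weights [al], [be] equal to 1 and 1 at even positions, and to 1 and 0, or
0 and 1, at odd positions according to [z].  Then [be - al] vanishes at the even
positions, and only the set of all even positions contributes to the pairing.
The signs on both sides amount to one factor -1 for each odd position with [z]. *)
Lemma sum_vdm_half_prescribed k (z : 'I_(k + k) -> bool) :
  \sum_(L : {set 'I_(k + k)} | (#|L| == k) && [forall i : 'I_(k + k), odd i ==> ((i \in L) == z i)])
     vdm L * vdm (~: L) = (2 ^+ 'C(k, 2) * superfact k) ^+ 2.
Proof.
pose al (i : 'I_(k + k)) : rat := if odd i then (z i)%:R else 1.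
pose be (i : 'I_(k + k)) : rat := if odd i then (~~ z i)%:R else 1.
pose zeta : rat := \prod_(i in parity_class k true) (if z i then -1 else 1).
have zeta_neq0 : zeta != 0.
  by apply/prodf_neq0 => i _; case: (z i); rewrite ?oppr_eq0 oner_eq0.
apply: (mulfI zeta_neq0); transitivity (vdm_pairing al be).
  rewrite big_distrr /= /vdm_pairing big_mkcondr; apply: eq_bigr => L _ /=.
  have [/forallP Lz|/forallPn[i]] := boolP [forall i : 'I_(k + k), odd i ==> ((i \in L) == z i)].
    have zL (i : 'I_(k + k)) : odd i -> (i \in L) = z i.
      by move=> oi; have := Lz i; rewrite oi => /eqP.
    rewrite [\prod_(i in ~: L) _]big1 ?mulr1; last first.
      by move=> i; rewrite inE /be => iL; case: ifP => // /zL <-; rewrite iL.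
    congr (_ * _); rewrite /zeta big_mkcond [RHS]big_mkcond; apply: eq_bigr => i _ /=.
    rewrite inE eqb_id /al -signr_odd; case oi: (odd i); last by rewrite mulr1 if_same.
    by rewrite zL //; case: (z i); rewrite ?mulr1.
  rewrite negb_imply => /andP[oi]; case iL: (i \in L) => /= nz.
    by rewrite (bigD1 i) //= /al oi; case: (z i) nz => //; rewrite !mulr0 !mul0r.
  rewrite [\prod_(j in ~: L) _](bigD1 i) ?inE ?iL //= /be oi.
  by case: (z i) nz => //; rewrite !(mul0r, mulr0).
rewrite vdm_pairing_sub /vdm_pairing (bigD1 (parity_class k false)) /=; last first.
  by rewrite card_parity_class.
have eC : ~: parity_class k false = parity_class k true.
  by apply/setP => i; rewrite !inE; case: odd.
rewrite eC !vdm_parity_class [X in _ + X]big1 ?addr0; last first.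
  move=> L /andP[/eqP cL nL].
  have /subsetPn[i ie iL] : ~~ (parity_class k false \subset L).
    apply: contra nL => sL; rewrite eq_sym eqEcard sL cL.
    by rewrite card_parity_class leqnn.
  rewrite [\prod_(j in ~: L) _](bigD1 i) ?inE ?iL //= /be /al.
  by move: ie; rewrite inE => /eqP ->; rewrite subrr !(mul0r, mulr0).
rewrite [\prod_(i in parity_class k false) _]big1 ?mul1r; last first.
  by move=> i; rewrite inE /al -signr_odd => /eqP ->; rewrite mulr1.
congr (_ * _); rewrite /zeta; apply: eq_bigr => i; rewrite inE eqb_id /be /al => ->.
by case: (z i); rewrite ?sub0r ?subr0.
Qed.

(** * Grid squares, shared edges and barriers *)

Lemma bottom_edge_sides (s u : square) :
  (bottom_edge s \in sides u) = (u == s) || (u == (s.1, s.2 - 1)).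
Proof.
case: s u => [a b] [x y]; rewrite !inE /bottom_edge /right_edge /top_edge /left_edge.
by rewrite !xpair_eqE /=; lia.
Qed.

Lemma right_edge_sides (s u : square) :
  (right_edge s \in sides u) = (u == s) || (u == (s.1 + 1, s.2)).
Proof.
case: s u => [a b] [x y]; rewrite !inE /bottom_edge /right_edge /top_edge /left_edge.
by rewrite !xpair_eqE /=; lia.
Qed.

Lemma left_edge_sides (s u : square) :
  (left_edge s \in sides u) = (u == s) || (u == (s.1 - 1, s.2)).
Proof.
case: s u => [a b] [x y]; rewrite !inE /bottom_edge /right_edge /top_edge /left_edge.
by rewrite !xpair_eqE /=; lia.
Qed.

Lemma top_edge_sides (s u : square) :
  (top_edge s \in sides u) = (u == s) || (u == (s.1, s.2 + 1)).
Proof.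
case: s u => [a b] [x y]; rewrite !inE /bottom_edge /right_edge /top_edge /left_edge.
by rewrite !xpair_eqE /=; lia.
Qed.

Lemma share_edgeE (s t : square) :
  share_edge s t = (`|s.1 - t.1| + `|s.2 - t.2| == 1).
Proof.
rewrite /share_edge /sides /= !(bottom_edge_sides, right_edge_sides, left_edge_sides, top_edge_sides).
case: s t => [a b] [x y]; rewrite !xpair_eqE /=; lia.
Qed.

Lemma share_edgeC (s t : square) : share_edge s t = share_edge t s.
Proof. by rewrite !share_edgeE ![`|_ - s.1|]distrC ![`|_ - s.2|]distrC. Qed.

(** A square next to a spine square lies below the spine when its first coordinate
exceeds the second. *)
Definition shuts (m : spine_mark) (v : square) : bool :=
  match m with Zig => v.2 < v.1 | Zag => v.1 < v.2 | Zip => false end.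

(** The two barriers of a zig separate its square from the two neighbours below the
spine, those of a zag from the two neighbours above it. *)
Lemma mark_barriers_shut (m : spine_mark) (s u v : square) : s.1 = s.2 -> share_edge u v ->
  has (fun e => (e \in sides u) && (e \in sides v)) (mark_barriers m s) =
  ((u == s) && shuts m v) || ((v == s) && shuts m u).
Proof.
case: s u v => [a b] [x y] [z t] /= <- {b}; rewrite share_edgeE /= => uv.
case: m; rewrite /= ?(bottom_edge_sides, right_edge_sides, left_edge_sides, top_edge_sides) //
  ?orbF !xpair_eqE /=.
- case: (eqVneq x a) => ?; case: (eqVneq y a) => ?; case: (eqVneq z a) => ?; case: (eqVneq t a) => ? /=; lia.
- case: (eqVneq x a) => ?; case: (eqVneq y a) => ?; case: (eqVneq z a) => ?; case: (eqVneq t a) => ? /=; lia.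
- by rewrite !andbF.
Qed.

(** * Blocks that respect the barriers and coordinates along the spine *)

Section Allowed.
Variables (n : nat) (m : nat -> spine_mark).

Definition allowed : {set {set cell n}} :=
  [set B | is_domino B & ~~ has (crosses B) (spine_barriers n m)].

Definition shut_at (u v : cell n) : bool :=
  [exists p : 'I_n.+1, [&& p \in layer n n, square_of u == spine_square n p.+1 &
     shuts (m p.+1) (square_of v)]].

Lemma card_tilings :
  #|[set P : {set {set cell n}} | domino_tiling P & compatible (spine_barriers n m) P]|
  = covers allowed (aztec n).
Proof.
apply: eq_card => P; rewrite !inE /domino_tiling /compatible -andbA; congr (_ && _).
apply/andP/subsetP => [[/forallP h1 /forallP h2] B BP|h].
  by rewrite inE; have := h1 B; have := h2 B; rewrite BP /= => -> ->.
by split; apply/forallP => B; apply/implyP => /h; rewrite inE => /andP[].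
Qed.

Lemma crosses_set2 (u v : cell n) e :
  crosses [set u; v] e = (e \in sides (square_of u)) && (e \in sides (square_of v)).
Proof.
apply/forallP/andP => [h|[h1 h2] c].
  by have := h v; have := h u; rewrite !in_set2 !eqxx orbT /= => -> ->.
by apply/implyP; rewrite in_set2 => /orP[] /eqP ->.
Qed.

Lemma layer_spine (p : 'I_n.+1) : (p \in layer n n) = (p.+1 <= (uphalf n).*2)%N.
Proof. by rewrite inE; lia. Qed.

Lemma allowed_set2 (u v : cell n) : share_edge (square_of u) (square_of v) ->
  ([set u; v] \in allowed) = ~~ shut_at u v && ~~ shut_at v u.
Proof.
move=> uv; rewrite inE.
have -> : is_domino [set u; v] by apply/existsP; exists u; apply/existsP; exists v; rewrite uv eqxx.
rewrite -negb_or; congr (~~ _).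
rewrite (eq_has (crosses_set2 u v)).
apply/hasP/orP => [[e /flatten_mapP[i]]|].
  rewrite mem_iota add1n ltnS => /andP[i1 i2] em euv.
  have : has (fun e => (e \in sides (square_of u)) && (e \in sides (square_of v)))
    (mark_barriers (m i) (spine_square n i)) by apply/hasP; exists e.
  have iN : (i.-1 < n.+1)%N by lia.
  rewrite mark_barriers_shut // => /orP[] /andP[us sv]; [left|right];
  apply/existsP; exists (Ordinal iN); rewrite layer_spine /= prednK // i2 us sv //.
have bar p : (p.+1 <= (uphalf n).*2)%N ->
  has (fun e => (e \in sides (square_of u)) && (e \in sides (square_of v)))
    (mark_barriers (m p.+1) (spine_square n p.+1)) ->
  exists2 x, x \in spine_barriers n m & 
    (x \in sides (square_of u)) && (x \in sides (square_of v)).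
  move=> p2 /hasP[e em euv]; exists e => //; apply/flatten_mapP; exists p.+1 => //.
  by rewrite mem_iota; lia.
case=> /existsP[p]; rewrite layer_spine => /and3P[pL us sv]; apply: (bar p pL);
  rewrite mark_barriers_shut // us sv //= orbT //.
Qed.

Lemma allowedP (B : {set cell n}) :
  B \in allowed -> exists u v, B = [set u; v] /\ share_edge (square_of u) (square_of v).
Proof.
rewrite inE => /andP[/existsP[u /existsP[v /andP[uv /eqP eB]]] _].
by exists u, v.
Qed.

End Allowed.

Section Coordinates.
Variables (n : nat) (u0 : 'I_n.*2).

(** The square at position [p] of diagonal [D] in the half above the spine if [b],
and in its mirror image below the spine otherwise; both agree on the spine. *)
Definition half_cell (b : bool) (D : nat) (p : 'I_n.+1) : cell n :=
  let x := insubd u0 (D./2 + p)%N in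
  let y := insubd u0 (p + n - uphalf D)%N in
  if b then (x, y) else (y, x).

Lemma half_cellE (b : bool) D (p : 'I_n.+1) : (D <= n)%N -> p \in layer n D ->
  ((if b then (half_cell b D p).1 else (half_cell b D p).2) = D./2 + p :> nat)%N /\
  ((if b then (half_cell b D p).2 else (half_cell b D p).1) + uphalf D = p + n :> nat)%N.
Proof.
rewrite inE => Dn pD; have n0 : (0 < n)%N by have := ltn_ord u0; lia.
rewrite /half_cell; case: b => /=; rewrite !val_insubd.
- have -> : (D./2 + p < n.*2)%N by lia.
  have -> : (p + n - uphalf D < n.*2)%N by lia.
  by split => //; lia.
- have -> : (D./2 + p < n.*2)%N by lia.
  have -> : (p + n - uphalf D < n.*2)%N by lia.
  by split => //; lia.
Qed.

Lemma in_aztecE (u : cell n) : (u \in aztec n) =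
  [&& n <= (u.1 + u.2).+1, (u.1 + u.2).+1 <= 3 * n, u.1 <= u.2 + n & u.2 <= u.1 + n]%N.
Proof. by rewrite inE /aztec_square /square_of /=; lia. Qed.

Lemma half_cell_inj b D D' p q : (D <= n)%N -> (D' <= n)%N ->
  p \in layer n D -> q \in layer n D' -> half_cell b D p = half_cell b D' q ->
  D = D' /\ p = q.
Proof.
move=> Dn D'n pL qL e.
have [a1 a2] := half_cellE b Dn pL; have [b1 b2] := half_cellE b D'n qL.
move: a1 a2 b1 b2; rewrite e; case: b {e} => a1 a2 b1 b2;
 have eD : D = D' by [lia]; split => //; subst D'; apply: val_inj => /=; lia.
Qed.

Lemma half_cell_spine b p : p \in layer n n ->
  square_of (half_cell b n p) = spine_square n p.+1.
Proof.
move=> pL; have [a1 a2] := half_cellE b (leqnn n) pL.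
by move: a1 a2; rewrite /square_of /spine_square; case: b => a1 a2; congr pair; lia.
Qed.

Lemma half_cell_swap b p : p \in layer n n -> half_cell b n p = half_cell true n p.
Proof.
case: b => // pL; have [a1 a2] := half_cellE false (leqnn n) pL.
have [b1 b2] := half_cellE true (leqnn n) pL; move: a1 a2 b1 b2.
case: (half_cell false n p) => x y; case: (half_cell true n p) => z t /= a1 a2 b1 b2.
by congr pair; apply: val_inj => /=; lia.
Qed.

Lemma half_cell_adj b D D' p q : (D <= n)%N -> (D' <= n)%N ->
  p \in layer n D -> q \in layer n D' ->
  share_edge (square_of (half_cell b D p)) (square_of (half_cell b D' q)) =
  ((D == D'.+1) && layer_nb D' p q) || ((D' == D.+1) && layer_nb D q p).
Proof.
move=> Dn D'n pL qL; rewrite share_edgeE /square_of.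
have [a1 a2] := half_cellE b Dn pL; have [b1 b2] := half_cellE b D'n qL.
move: a1 a2 b1 b2; case: (half_cell b D p) => x y; case: (half_cell b D' q) => z t /=.
move: pL qL; rewrite !inE /layer_nb /nb_up /nb_down; case: b => pL qL a1 a2 b1 b2;
case: (odd D) (odd_double_half D) => hD; case: (odd D') (odd_double_half D') => hD';
lia.
Qed.

Lemma half_cell_aztec b D p : (D <= n)%N -> p \in layer n D -> half_cell b D p \in aztec n.
Proof.
move=> Dn pL; rewrite in_aztecE; have [] := half_cellE b Dn pL.
by move: pL; rewrite inE; case: b => pL a1 a2; lia.
Qed.

Lemma half_cell_side b D p : (D <= n)%N -> p \in layer n D ->
  ((if b then (half_cell b D p).2 else (half_cell b D p).1) + D =
   (if b then (half_cell b D p).1 else (half_cell b D p).2) + n :> nat)%N.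
Proof. by move=> Dn pL; have [] := half_cellE b Dn pL; case: b; lia. Qed.

Lemma aztec_half_cell b (u : cell n) : u \in aztec n ->
  ((if b then u.1 else u.2) <= (if b then u.2 else u.1))%N ->
  exists D p, [/\ (D <= n)%N, p \in layer n D & u = half_cell b D p].
Proof.
rewrite in_aztecE => /and4P[h1 h2 h3 h4] h.
pose x : nat := if b then u.1 else u.2; pose y : nat := if b then u.2 else u.1.
pose D := (x + n - y)%N.
have pN : (x - D./2 < n.+1)%N by rewrite /D /x /y; case: (b) h => h; lia.
have Dn : (D <= n)%N by rewrite /D /x /y; case: (b) h => h; lia.
have pL : Ordinal pN \in layer n D.
  by rewrite inE /= /D /x /y; case: (b) h => h; lia.
exists D, (Ordinal pN); split => //.
have [] := half_cellE b Dn pL; move: (half_cell b D _) => /= w.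
move: h h1 h2 h3 h4 Dn; rewrite /D /x /y; case: (b); case: (u) => a c; case: (w) => a' c' /= *;
  by congr pair; apply: val_inj => /=; lia.
Qed.

End Coordinates.

(** * Cutting the Aztec diamond along its spine *)

(** A zag cuts a spine square off from the half above the spine ([b] true), a zig
from the half below it. *)
Definition shuts_side (b : bool) (mk : spine_mark) : bool :=
  match mk with Zig => ~~ b | Zag => b | Zip => false end.

Section Halves.
Variables (n : nat) (u0 : 'I_n.*2) (m : nat -> spine_mark).
Notation hc := (half_cell u0).

Definition half_region b (A : {set 'I_n.+1}) : {set cell n} :=
  region (hc b) n :|: [set hc b n p | p in A].

Lemma half_regionP b (A : {set 'I_n.+1}) y : A \subset layer n n -> y \in half_region b A ->
  exists D p, [/\ (D <= n)%N, p \in layer n D, y = hc b D p & D = n -> p \in A].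
Proof.
move=> sA; rewrite inE => /orP[/regionP[D [p [Dn pL ->]]]|/imsetP[p pA ->]].
  by exists D, p; split => //; [apply: ltnW|move=> e; rewrite e ltnn in Dn].
by exists n, p; split => //; apply: (subsetP sA).
Qed.

Lemma square_of_inj : injective (@square_of n).
Proof.
move=> [a c] [x y]; rewrite /square_of /= => -[e1 e2].
by congr pair; apply: val_inj => /=; lia.
Qed.

Lemma shut_at_half b D D' p q : (D <= n)%N -> (D' < n)%N ->
  p \in layer n D -> q \in layer n D' ->
  shut_at m (hc b D p) (hc b D' q) = (D == n) && shuts_side b (m p.+1).
Proof.
move=> Dn D'n pL qL.
have := half_cell_side u0 b (ltnW D'n) qL => e.
have sE mk : shuts mk (square_of (hc b D' q)) = shuts_side b mk.
  by rewrite /square_of; move: e; case: b; case: mk => //= e; lia.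
apply/existsP/andP => [[p' /and3P[p'L /eqP]]|[/eqP eD sp]].
  rewrite -(half_cell_spine u0 b p'L) => /square_of_inj.
  move=> /half_cell_inj -/(_ Dn (leqnn n) pL p'L) [-> ->].
  by rewrite sE.
by subst D; exists p; rewrite pL sE sp (half_cell_spine u0 b pL) eqxx.
Qed.

(** If no prescribed spine square is cut off from this half, the barriers do not
matter inside it; otherwise the square that is cut off cannot be covered. *)
Lemma covers_half b (A : {set 'I_n.+1}) (K : {set {set cell n}}) : A \subset layer n n ->
  (forall B : {set cell n}, B \subset half_region b A -> (B \in K) = (B \in allowed n m)) ->
  (covers K (half_region b A))%:R =
  if [forall p in A, ~~ shuts_side b (m p.+1)] then half_count n A else 0.
Proof.
move=> sA eK; have [/forall_inP nA|] := boolP [forall p in A, ~~ shuts_side b (m p.+1)]; last first.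
  rewrite negb_forall => /existsP[p]; rewrite negb_imply negbK => /andP[pA sp].
  have pL := subsetP sA _ pA.
  rewrite (@covers_eq0 _ _ _ (hc b n p)) //; first by rewrite inE imset_f ?orbT.
  move=> B sB BK; apply/negP => pB; move: (BK); rewrite eK // => /allowedP[u [v [eB uv]]].
  (* The partner of the cut off spine square would lie on the diagonal next to the
     spine, on the side that the barriers of this square close. *)
  wlog eu : u v eB uv / u = hc b n p.
    move=> W; move: pB; rewrite eB in_set2 => /orP[/eqP eu|/eqP ev].
      by apply: (W u v).
    by apply: (W v u); rewrite // 1?setUC // share_edgeC.
  have vB : v \in half_region b A by apply: (subsetP sB); rewrite eB in_set2 eqxx orbT.
  have [D [q [Dn qL ev _]]] := half_regionP sA vB.
  move: BK; rewrite eK // eB allowed_set2 // eu ev.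
  move: uv; rewrite eu ev half_cell_adj // => /orP[] /andP[/eqP eD _]; last by lia.
  by rewrite shut_at_half // ?eD // eqxx sp.
apply: region_covers => //; first by move=> *; apply: half_cell_inj; eassumption.
move=> B sB; rewrite eK //; split.
  move=> /allowedP[u [v [eB uv]]].
  have uB : u \in half_region b A by apply: (subsetP sB); rewrite eB in_set2 eqxx.
  have vB : v \in half_region b A by apply: (subsetP sB); rewrite eB in_set2 eqxx orbT.
  have [D [p [Dn pL eu _]]] := half_regionP sA uB.
  have [D' [q [D'n qL ev _]]] := half_regionP sA vB.
  move: uv; rewrite eu ev half_cell_adj // => /orP[] /andP[/eqP eD nb]; subst.
    by exists D', p, q.
  by exists D, q, p; rewrite setUC.
move=> [E [p [q [En pL qL nb eB]]]]; rewrite eB allowed_set2; last first.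
  by rewrite half_cell_adj // ?(ltnW En) // eqxx nb.
rewrite shut_at_half //; apply/andP; split.
  apply/negP => /andP[/eqP eE]; apply/negP; apply: nA.
  have : hc b E.+1 p \in half_region b A by apply: (subsetP sB); rewrite eB in_set2 eqxx.
  case/(half_regionP sA) => D [p' [Dn p'L]] /half_cell_inj.
  by move=> /(_ En Dn pL p'L) [eD ->]; apply; rewrite -eD.
apply/negP => /existsP[p' /and3P[p'L /eqP]].
rewrite -(half_cell_spine u0 b p'L) => /square_of_inj /half_cell_inj.
move=> /(_ (ltnW En) (leqnn n) qL p'L) [e _]; lia.
Qed.

End Halves.

Lemma sum_support_imset (I J : finType) (P : pred J) (Q : {set I}) (g : I -> J) (F : J -> nat) :
  {in Q &, injective g} -> (forall x, x \in Q -> P (g x)) ->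
  (forall y, P y -> y \notin g @: Q -> F y = 0%N) ->
  (\sum_(y | P y) F y = \sum_(x in Q) F (g x))%N.
Proof.
move=> g_inj gP F0; rewrite (bigID (mem (g @: Q))) /= [X in (_ + X)%N]big1 ?addn0; last first.
  by move=> y /andP[]; apply: F0.
rewrite -(big_imset F g_inj); apply: eq_bigl => y /=.
by rewrite andbC; apply: andb_idr => /imsetP[x /gP Px ->].
Qed.

Section Spine.
Variables (n : nat) (u0 : 'I_n.*2) (m : nat -> spine_mark).
Notation hc := (half_cell u0).
Notation half := (half_region u0).

Lemma half_region_disjoint (A : {set 'I_n.+1}) D p : A \subset layer n n -> (D < n)%N -> p \in layer n D ->
  hc false D p \notin half true A.
Proof.
move=> sA Dn pL; apply/negP => /(half_regionP sA)[D' [q [D'n qL e _]]].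
have := half_cell_side u0 true D'n qL; have := half_cell_side u0 false (ltnW Dn) pL.
rewrite e; lia.
Qed.

Lemma spine_in_half b (A : {set 'I_n.+1}) p : A \subset layer n n -> p \in layer n n ->
  (hc b n p \in half b A) = (p \in A).
Proof.
move=> sA pL; apply/idP/idP => [/(half_regionP sA)[D [q [Dn qL]]]|pA]; last first.
  by rewrite inE imset_f ?orbT.
by move=> /half_cell_inj -/(_ (leqnn n) Dn pL qL) [<- ->]; apply.
Qed.

Lemma aztec_setD_half (A : {set 'I_n.+1}) : A \subset layer n n ->
  aztec n :\: half true A = half false (layer n n :\: A).
Proof.
move=> sA; have sA' : layer n n :\: A \subset layer n n by apply: subsetDl.
apply/setP => u; rewrite in_setD; apply/andP/idP => [[nu uz]|].
  have [le|le] := leqP u.1 u.2.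
    have [D [p [Dn pL eu]]] := @aztec_half_cell n u0 true u uz le.
    have [eD|nD] := eqVneq D n.
      subst D; rewrite eu -(half_cell_swap u0 false pL) spine_in_half // inE pL andbT.
      by rewrite -(spine_in_half true sA) // -eu.
    case/negP: nu; rewrite inE; apply/orP; left; apply/regionP.
    by exists D, p; split; rewrite // ltn_neqAle nD.
  have [D [p [Dn pL eu]]] := @aztec_half_cell n u0 false u uz (ltnW le).
  rewrite inE; apply/orP; left; apply/regionP; exists D, p; split => //.
  have := half_cell_side u0 false Dn pL; rewrite -eu; lia.
case/(half_regionP sA') => D [p [Dn pL -> DA]]; split; last exact: half_cell_aztec.
have [eD|nD] := eqVneq D n; last by apply: half_region_disjoint; rewrite // ltn_neqAle nD.
have := DA eD; subst D; rewrite (half_cell_swap u0 false pL) spine_in_half //.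
by rewrite inE => /andP[].
Qed.

Lemma half_sub_aztec b (A : {set 'I_n.+1}) : A \subset layer n n -> half b A \subset aztec n.
Proof.
move=> sA; apply/subsetP => u /(half_regionP sA)[D [p [Dn pL -> _]]].
exact: half_cell_aztec.
Qed.

Definition unshut (A : {set 'I_n.+1}) : bool :=
  [forall p in layer n n, ~~ shuts_side (p \in A) (m p.+1)].

(** Blocks are split into those that meet the open half above the spine and the
others.  The region filled by the first kind contains that half and misses the
open half below, so it is determined by its set [A] of spine squares. *)
Lemma covers_aztec :
  (covers (allowed n m) (aztec n))%:R =
  \sum_(A in powerset (layer n n) | unshut A)
     half_count n A * half_count n (layer n n :\: A) :> rat.
Proof.
pose R := region (hc true) n.
pose K1 := [set B in allowed n m | B :&: R != set0].
pose K2 := allowed n m :\: K1.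
have sK : K1 \subset allowed n m by apply/subsetP => B; rewrite inE => /andP[].
have -> : allowed n m = K1 :|: K2 by rewrite -{1}(setID (allowed n m) K1) (setIidPr sK).
rewrite covers_split; last by rewrite disjoint_sym; apply/setDidPl; rewrite setDDl setUid.
rewrite (@sum_support_imset _ _ _ (powerset (layer n n)) (half true)); first last.
- move=> Y sY nY.
  (* No block of [K2] meets [R], so all of [R] has to be filled by [K1]. *)
  have [/subsetP RY|/subsetPn[y yR yY]] := boolP (R \subset Y); last first.
    rewrite (@covers_eq0 _ K2 _ y) ?muln0 //.
      rewrite inE yY /=; apply: (subsetP (half_sub_aztec true (sub0set _))).
      by rewrite inE yR.
    move=> B _; rewrite !inE negb_and negbK => /andP[/orP[/negbTE->//|/eqP e] _].
    by apply/negP => yB; have : y \in B :&: R by [rewrite inE yB]; rewrite e inE.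
  (* A block of [K1] meets [R], and no domino reaches from there across the spine. *)
  have [Y0|] := boolP [forall D : 'I_n, [forall p in layer n D, hc false D p \notin Y]];
    last first.
    rewrite negb_forall => /existsP[D]; rewrite negb_forall => /existsP[p].
    rewrite negb_imply negbK => /andP[pL pY].
    rewrite (@covers_eq0 _ K1 _ (hc false D p)) //.
    move=> B _; rewrite inE => /andP[/allowedP[u [v [eB uv]]] /set0Pn[y]].
    rewrite inE => /andP[yB /regionP[D' [q [D'n qL ey]]]]; apply/negP => pB.
    have := half_cell_side u0 true (ltnW D'n) qL.
    have := half_cell_side u0 false (ltnW (ltn_ord D)) pL.
    have Dn := ltn_ord D; move: yB pB uv; rewrite ey eB !in_set2 share_edgeE /square_of.
    move: (hc false D p) (hc true D' q) => y1 y2 y2B y1B uv /= h1 h2.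
    by move: y2B y1B uv h1 h2 => /orP[] /eqP -> /orP[] /eqP -> /=; lia.
  case/imsetP: nY; exists [set p in layer n n | hc true n p \in Y].
    by rewrite inE; apply/subsetP => p; rewrite inE => /andP[].
  set A := [set p in _ | _].
  have sA : A \subset layer n n by apply/subsetP => p; rewrite inE => /andP[].
  apply/eqP; rewrite eqEsubset; apply/andP; split; apply/subsetP => y; last first.
    rewrite inE => /orP[|/imsetP[p]]; first exact: RY.
    by rewrite inE => /andP[_ ?] ->.
  move=> yY; have yz := subsetP sY _ yY; apply: contraLR (yY) => ny.
  have : y \in aztec n :\: half true A by rewrite in_setD ny.
  rewrite aztec_setD_half // inE => /orP[/regionP[D [p [Dn pL ->]]]|/imsetP[p]].
    by have /forallP /(_ (Ordinal Dn)) /forall_inP := Y0; apply.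
  rewrite inE => /andP[nA pL ->]; rewrite (half_cell_swap u0 false pL).
  by move: nA; rewrite inE pL.
- by move=> A; rewrite inE; apply: half_sub_aztec.
- move=> A A'; rewrite !inE => sA sA' e; apply/setP => p.
  have [pL|pL] := boolP (p \in layer n n).
    by rewrite -(spine_in_half true sA) // e spine_in_half.
  by rewrite (negbTE (contra (subsetP sA p) pL)) (negbTE (contra (subsetP sA' p) pL)).
rewrite natr_sum [RHS]big_mkcondr; apply: eq_bigr => A; rewrite inE => sA.
have sA' : layer n n :\: A \subset layer n n by apply: subsetDl.
rewrite natrM aztec_setD_half // (covers_half (m := m) sA) ?(covers_half (m := m) sA');
  last 2 first.
- move=> B sB; rewrite in_setD; case BK : (B \in allowed n m); rewrite ?andbF // andbT.
  rewrite /K1 inE BK /= negbK; apply/eqP/setP => y; rewrite in_set0; apply/negP.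
  rewrite inE => /andP[/(subsetP sB) yB /regionP[D [p [Dn pL ey]]]].
  have [D' [q [D'n qL ey' _]]] := half_regionP sA' yB.
  have := half_cell_side u0 true (ltnW Dn) pL; have := half_cell_side u0 false D'n qL.
  rewrite -ey -ey'; lia.
- move=> B sB; rewrite inE; case BK : (B \in allowed n m) => //=.
  have [u [v [eB uv]]] := allowedP BK.
  have uB : u \in half true A by apply: (subsetP sB); rewrite eB in_set2 eqxx.
  have vB : v \in half true A by apply: (subsetP sB); rewrite eB in_set2 eqxx orbT.
  have [D [p [Dn pL eu _]]] := half_regionP sA uB.
  have [D' [q [D'n qL ev _]]] := half_regionP sA vB.
  move: uv; rewrite eu ev half_cell_adj // => /orP[] /andP[/eqP eD nb].
    apply/set0Pn; exists v; rewrite inE eB in_set2 eqxx orbT /=.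
    by apply/regionP; exists D', q; split => //; rewrite -eD.
  apply/set0Pn; exists u; rewrite inE eB in_set2 eqxx /=.
  by apply/regionP; exists D, p; split => //; rewrite -eD.
have -> : unshut A = [forall p in A, ~~ shuts_side true (m p.+1)] &&
    [forall p in layer n n :\: A, ~~ shuts_side false (m p.+1)].
  apply/forall_inP/andP => [h|[/forall_inP h1 /forall_inP h2] p pL].
    split; apply/forall_inP => p.
      by move=> pA; have := h p (subsetP sA p pA); rewrite pA.
    by rewrite inE => /andP[/negbTE pA pL]; have := h p pL; rewrite pA.
  case pA : (p \in A); first exact: h1.
  by apply: h2; rewrite inE pA.
by do 2![case: ifP => _]; rewrite ?mulr0 ?mul0r.
Qed.

End Spine.

(** * The number of compatible tilings *)

Lemma layer_spineE n : layer n n = seg n.+1 (uphalf n + uphalf n).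
Proof. by apply/setP => p; rewrite !inE; lia. Qed.

(** The spine has [2 * k] squares, so that in both parities of [n] one factor
contributes [vdm A] and the other that of the complement. *)
Lemma half_count_pair n (A : {set 'I_n.+1}) (k := uphalf n) : A \subset layer n n ->
  half_count n A * half_count n (layer n n :\: A) =
  if #|A| == k then (2 ^+ 'C(n./2.+1, 2) / superfact k) ^+ 2 *
     (vdm A * vdm (layer n n :\: A)) else 0.
Proof.
move=> sA; have cL : #|layer n n| = (k + k)%N.
  by rewrite layer_spineE card_seg // /k; lia.
have cA : (#|layer n n :\: A| == k) = (#|A| == k).
  have := subset_leq_card sA.
  by rewrite cardsD (setIidPr sA) cL; lia.
have DD : layer n n :\: (layer n n :\: A) = A by rewrite setDDr setDv set0U (setIidPr sA).
rewrite /half_count -/k DD; case: (odd n); rewrite cA;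
  case: eqP => _; rewrite ?mul0r //; ring.
Qed.

(** The marks at the odd positions prescribe which of these belong to [A], and the
positions of the spine are those of ['I_(k + k)]. *)
Lemma sum_spine n (m : nat -> spine_mark) (k := uphalf n)
  (hodd : forall i : nat, (1 <= i <= k.*2)%N -> odd i -> m i = Zip)
  (heven : forall i : nat, (1 <= i <= k.*2)%N -> ~~ odd i -> m i = Zig \/ m i = Zag) :
  \sum_(A in powerset (layer n n) | unshut m A)
     half_count n A * half_count n (layer n n :\: A) =
  (2 ^+ 'C(n./2.+1, 2) * 2 ^+ 'C(k, 2)) ^+ 2.
Proof.
have kn : (k + k <= n.+1)%N by rewrite /k; lia.
pose f := widen_ord kn; have fE i : f i = i :> nat by [].
have f_inj : injective f by move=> i j /(congr1 val) /= /val_inj.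
have lE : layer n n = f @: setT.
  apply/setP => p; rewrite layer_spineE inE; apply/idP/imsetP => [pk|[i _ ->]].
    by exists (Ordinal pk) => //; apply: val_inj.
  exact: (ltn_ord i).
have pE : powerset (layer n n) = (fun L : {set 'I_(k + k)} => f @: L) @: setT.
  apply/setP => A; rewrite inE; apply/idP/imsetP => [sA|[L _ ->]]; last first.
    by rewrite lE; apply: imsetS; apply: subsetT.
  exists (f @^-1: A) => //; apply/setP => p; apply/idP/imsetP => [pA|[i]]; last first.
    by rewrite inE => fA ->.
  have := subsetP sA _ pA; rewrite lE => /imsetP[i _ e].
  by exists i => //; rewrite inE -e.
rewrite big_mkcondr pE big_imset /=; last by move=> L L' _ _; apply: imset_inj.
pose z (i : 'I_(k + k)) := if m i.+1 is Zig then true else false.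
have uE (L : {set 'I_(k + k)}) : unshut m (f @: L) = [forall i : 'I_(k + k), odd i ==> ((i \in L) == z i)].
  have iL i : (f i \in f @: L) = (i \in L) by rewrite (mem_imset _ _ f_inj).
  apply/forall_inP/forallP => h.
    move=> i; apply/implyP => oi; have := h (f i); rewrite lE imset_f // iL fE => /(_ isT).
    have ik : (1 <= i.+1 <= k.*2)%N by have := ltn_ord i; lia.
    by have := heven _ ik; rewrite /= negbK => /(_ oi) [] e; rewrite /z e; case: (i \in L).
  move=> p; rewrite lE => /imsetP[i _ ->]; rewrite iL fE.
  have := h i; have ik : (1 <= i.+1 <= k.*2)%N by have := ltn_ord i; lia.
  case oi: (odd i) => /=; last by rewrite hodd //= oi.
  by have := heven _ ik; rewrite /= negbK oi => /(_ isT) [] e; rewrite e /z e => /eqP ->.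
transitivity (\sum_(L : {set 'I_(k + k)} |
    (#|L| == k) && [forall i : 'I_(k + k), odd i ==> ((i \in L) == z i)])
    (2 ^+ 'C(n./2.+1, 2) / superfact k) ^+ 2 * (vdm L * vdm (~: L))).
  rewrite big_mkcond [RHS]big_mkcond; apply: eq_bigr => L _; rewrite in_setT uE.
  have sL : f @: L \subset layer n n by rewrite lE; apply: imsetS; apply: subsetT.
  rewrite half_count_pair // (card_imset _ f_inj) andbC.
  case: [forall i, _] => //=; case: (#|L| == _) => //.
  have -> : layer n n :\: f @: L = f @: (~: L).
    apply/setP => p; rewrite inE lE; apply/andP/imsetP => [[np /imsetP[i _ e]]|[i]].
      by exists i => //; rewrite inE; apply: contra np => iL; rewrite e imset_f.
    by rewrite inE => iL ->; rewrite mem_imset // iL imset_f.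
  by rewrite !vdm_imset_mono.
rewrite -big_distrr /= sum_vdm_half_prescribed; field.
by apply: lt0r_neq0; apply: superfact_gt0.
Qed.

Theorem theorem1 (n : nat) (hn : (1 <= n)%N) (m : nat -> spine_mark)
  (hodd : forall i : nat, (1 <= i <= (uphalf n).*2)%N -> odd i -> m i = Zip)
  (heven : forall i : nat, (1 <= i <= (uphalf n).*2)%N -> ~~ odd i ->
     m i = Zig \/ m i = Zag) :
  (#|[set P : {set {set cell n}} |
       domino_tiling P & compatible (spine_barriers n m) P]|)%:R
  = 2 ^+ (n * n.+1)./2 / 2 ^+ uphalf n :> rat.
Proof.
have n2 : (0 < n.*2)%N by rewrite double_gt0.
rewrite card_tilings (covers_aztec (Ordinal n2)) (sum_spine hodd heven).
(* Both exponents on the left come twice, and [2 ^+ uphalf n] clears the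
   denominator. *)
rewrite -exprD -exprM -[X in X / _](_ : 2 ^+ (('C(n./2.+1, 2) + 'C(uphalf n, 2)) * 2 + uphalf n) = _).
  by rewrite exprD mulfK // expf_neq0.
congr (_ ^+ _).
have C2 x : ('C(x.+1, 2) * 2 = x.+1 * x)%N by elim: x => // x IH; rewrite binS bin1 mulnDl IH; lia.
have C2' x : ('C(x, 2) * 2 = x * x.-1)%N by case: x => [|x]; rewrite ?C2.
have -> : (n * n.+1 = ((n./2.+1 * n./2 + uphalf n * (uphalf n).-1) + uphalf n).*2)%N.
  have := odd_double_half n; rewrite uphalf_half.
  by move: n./2 (odd n) => h [] <-; case: h => [|h] //=; nia.
by rewrite doubleK mulnDl C2 C2'.
Qed.
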